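(* Let $\sigma\colon\Gamma\to2^V$ be a quasi-geometric homology triangulation of a simplex and $E$ a face of $\Gamma$ with $\ell(\Gamma,E)=0$. Suppose $F\in\mathrm{lk}_\Gamma(E)$ has an interior partition $F=F_1\sqcup F_2\sqcup\mathcal{A}_F$ with $|F_1|\le2$. Then $F$ is a $U$-pyramid.
   Context: Fix an infinite field $k$; homology is with coefficients in $k$. A $d$-dimensional simplicial complex $\Gamma$ with trivial reduced homology is a homology ball of dimension $d$ if there is a subcomplex $\partial\Gamma$ such that $\partial\Gamma$ is a homology sphere of dimension $d-1$, $\mathrm{lk}_\Gamma(F)$ is a homology sphere of dimension $d-|F|$ for $F\notin\partial\Gamma$, and $\mathrm{lk}_\Gamma(F)$ is a homology ball of dimension $d-|F|$ for nonempty $F\in\partial\Gamma$; its interior faces are those not in $\partial\Gamma$. A homology triangulation of $2^V$ is a finite simplicial complex $\Gamma$ with $\sigma\colon\Gamma\to2^V$ such that for every nonempty $U\subset V$, $\Gamma_U:=\sigma^{-1}(2^U)$ is a homology ball of dimension $|U|-1$ whose interior faces are exactly $\sigma^{-1}(U)$. $\sigma(F)$ is the carrier; $\sigma(w)=\sigma(\{w\})$. It is quasi-geometric if there is no face $F$ and $U\subset V$ with $\dim\Gamma_U<\dim F$ and $\sigma(w)\subset U$ for all vertices $w\in F$. $U^c=V\smallsetminus U$. A face $G$ is interior if $\sigma(G)=V$. $k[\Delta]$ is the face ring (variables $x_w$, $x^F=\prod_{w\in F}x_w$), graded by degree. An l.s.o.p. for a finitely generated graded $k$-algebra of Krull dimension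 $d$ is a sequence of $d$ degree-one elements with finite-dimensional quotient. For a face $E$, an l.s.o.p. $\theta_1,\ldots,\theta_d$ of $k[\mathrm{lk}_\Gamma(E)]$ ($d=|V|-|E|$) is special if for each $v\in V\smallsetminus\sigma(E)$ there is an element $\theta_v$ of it supported on vertices $w$ with $v\in\sigma(w)$, with $\theta_v\ne\theta_{v'}$ for $v\ne v'$. The local face module $L(\Gamma,E)$ is the image of $(x^F:F\in\mathrm{lk}_\Gamma(E),\ F\sqcup E\text{ interior})$ in $k[\mathrm{lk}_\Gamma(E)]/(\theta_1,\ldots,\theta_d)$ for a special l.s.o.p.; the local $h$-vector $\ell(\Gamma,E)=(\ell_0,\ldots,\ell_d)$, $\ell_i=\dim_kL(\Gamma,E)_i$, is independent of the choice of special l.s.o.p. For $F\in\mathrm{lk}_\Gamma(E)$ with $F\sqcup E$ interior: $F$ is a pyramid with apex $w\in F$ if $(F\sqcup E)\smallsetminus\{w\}$ is not interior; $\mathcal{A}_F$ is the set of such apexes $w$; $V_w:=\sigma((F\sqcup E)\smallsetminus\{w\})^c$; $F$ is a $U$-pyramid if there is $w\in\mathcal{A}_F$ with $|V_w|=1$. An interior partition of a face $F\in\mathrm{lk}_\Gamma(E)$ is a decomposition $F=F_1\sqcup F_2\sqcup\mathcal{A}_F$ such that $F_1\sqcup\mathcal{A}_F\sqcup E$ and $F_2\sqcup\mathcal{A}_F\sqcup E$ are both interior. *)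

(* Defs.v *)
From HB Require Import structures.
From mathcomp Require Import all_boot all_order all_algebra.
From mathcomp Require Import mpoly.
Set Implicit Arguments. Unset Strict Implicit. Unset Printing Implicit Defensive.
Import Order.TTheory GRing.Theory.
Local Open Scope ring_scope.

Section Defs.
Variable n : nat.
Notation cplx := {set {set 'I_n}}.

Definition is_complex (D : cplx) : Prop :=
  set0 \in D /\ forall F G : {set 'I_n}, F \in D -> G \subset F -> G \in D.

Definition link (D : cplx) (E : {set 'I_n}) : cplx :=
  [set G in D | [disjoint G & E] && (G :|: E \in D)].

(* Simplicial homology over a field k, via boundary matrices indexed by
   {set 'I_n}; faces of size s span the chain group C_{s-1}. *)
Definition bd (k : fieldType) (D : cplx) (s : nat) : 'M[k]_#|{set 'I_n}| :=
  \matrix_(i, j)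
    (let F := enum_val i in let G := enum_val j in
     if (F \in D) && (#|F| == s) then
       \sum_(w in F) (if G == F :\ w then (-1) ^+ #|[set u in F | (u < w)%N]|
                      else 0)
     else 0).

Definition cdim (D : cplx) (s : nat) : nat := #|[set F in D | #|F| == s]|.

(* dimension of the reduced homology group H~_{s-1}(D; k) *)
Definition rbetti (k : fieldType) (D : cplx) (s : nat) : nat :=
  (cdim D s - \rank (bd k D s) - \rank (bd k D s.+1))%N.

(* homology sphere of dimension r-1 (r = dimension + 1) *)
Definition hsphere (k : fieldType) (r : nat) (D : cplx) : Prop :=
  is_complex D /\
  forall F, F \in D -> forall s, rbetti k (link D F) s = (s + #|F| == r)%N.

(* homology ball of dimension r-1 with boundary B (fuel for the recursion) *)
Fixpoint hball_fuel (k : fieldType) (fuel r : nat) (D B : cplx) : Prop :=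
  match fuel with
  | 0 => False
  | fuel'.+1 =>
    [/\ is_complex D /\
        ((exists2 F, F \in D & #|F| = r) /\ (forall F, F \in D -> #|F| <= r)%N),
        (forall s, rbetti k D s = 0%N),
        B \subset D /\ hsphere k r.-1 B,
        (forall F, F \in D -> F \notin B -> hsphere k (r - #|F|) (link D F)) &
        (forall F, F \in B -> F != set0 ->
           exists B', hball_fuel k fuel' (r - #|F|) (link D F) B')]
  end.

Definition hball (k : fieldType) (r : nat) (D B : cplx) : Prop :=
  hball_fuel k r.+1 r D B.

Variable V : finType.

Definition GammaU (G : cplx) (sigma : {set 'I_n} -> {set V}) (U : {set V}) : cplx :=
  [set F in G | sigma F \subset U].

Definition homology_triangulation (k : fieldType) (G : cplx)
  (sigma : {set 'I_n} -> {set V}) : Prop :=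
  is_complex G /\
  forall U : {set V}, U != set0 ->
    exists B, hball k #|U| (GammaU G sigma U) B /\
      [set F in GammaU G sigma U | F \notin B] = [set F in G | sigma F == U].

Definition maxsize (D : cplx) : nat := (\max_(F in D) #|F|)%N.

Definition quasi_geometric (G : cplx) (sigma : {set 'I_n} -> {set V}) : Prop :=
  ~ exists (F : {set 'I_n}) (U : {set V}),
      [/\ F \in G, (maxsize (GammaU G sigma U) < #|F|)%N &
          forall w, w \in F -> sigma [set w] \subset U].

Definition interior (sigma : {set 'I_n} -> {set V}) (F : {set 'I_n}) : bool :=
  sigma F == [set: V].

Definition mono (k : fieldType) (F : {set 'I_n}) : {mpoly k[n]} :=
  \prod_(w in F) 'X_w.

Definition linform (k : fieldType) (t : 'I_n -> k) : {mpoly k[n]} :=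
  \sum_w t w *: 'X_w.

Definition in_ideal (k : fieldType) (gs : seq {mpoly k[n]}) (p : {mpoly k[n]}) :=
  exists c : 'I_(size gs) -> {mpoly k[n]},
    p = \sum_(i < size gs) c i * nth 0 gs i.

Definition SR_gens (k : fieldType) (D : cplx) : seq {mpoly k[n]} :=
  [seq mono k N | N <- enum (~: D)].

Definition lsop_gens (k : fieldType) (D : cplx) (d : nat)
  (t : 'I_d -> 'I_n -> k) : seq {mpoly k[n]} :=
  SR_gens k D ++ [seq linform (t j) | j <- enum 'I_d].

(* t_1..t_d are degree-one elements of k[D] (linear forms in the vertex
   variables of D) with k[D]/(t) finite dimensional over k *)
Definition is_lsop (k : fieldType) (D : cplx) (d : nat) (t : 'I_d -> 'I_n -> k) :=
  (forall j w, t j w != 0 -> [set w] \in D) /\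
  exists s : seq {mpoly k[n]}, forall p : {mpoly k[n]},
    exists a : 'I_(size s) -> k,
      in_ideal (lsop_gens D t) (p - \sum_(i < size s) a i *: nth 0 s i).

Definition special (k : fieldType) (sigma : {set 'I_n} -> {set V})
  (E : {set 'I_n}) (d : nat) (t : 'I_d -> 'I_n -> k) :=
  exists f : V -> 'I_d,
    {in ~: sigma E &, injective f} /\
    forall v, v \notin sigma E -> forall w, t (f v) w != 0 -> v \in sigma [set w].

(* L(Gamma,E) = 0 : every generator x^F vanishes in k[lk E]/(t) *)
Definition local_module_zero (k : fieldType) (G : cplx)
  (sigma : {set 'I_n} -> {set V}) (E : {set 'I_n}) (d : nat)
  (t : 'I_d -> 'I_n -> k) :=
  forall F, F \in link G E -> interior sigma (F :|: E) ->
    in_ideal (lsop_gens (link G E) t) (mono k F).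

(* ell(Gamma,E) = 0, computed with a special l.s.o.p. (independent of choice) *)
Definition local_h_zero (k : fieldType) (G : cplx)
  (sigma : {set 'I_n} -> {set V}) (E : {set 'I_n}) : Prop :=
  exists t : 'I_(#|V| - #|E|) -> 'I_n -> k,
    [/\ is_lsop (link G E) t, special sigma E t & local_module_zero G sigma E t].

Definition apexes (sigma : {set 'I_n} -> {set V}) (E F : {set 'I_n}) : {set 'I_n} :=
  [set w in F | ~~ interior sigma ((F :|: E) :\ w)].

Definition Vw (sigma : {set 'I_n} -> {set V}) (E F : {set 'I_n}) (w : 'I_n) : {set V} :=
  ~: sigma ((F :|: E) :\ w).

Definition U_pyramid (sigma : {set 'I_n} -> {set V}) (E F : {set 'I_n}) : Prop :=
  exists2 w, w \in apexes sigma E F & #|Vw sigma E F w| = 1%N.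

Definition interior_partition (sigma : {set 'I_n} -> {set V})
  (E F F1 F2 : {set 'I_n}) : Prop :=
  let A := apexes sigma E F in
  [/\ [&& [disjoint F1 & F2], [disjoint F1 & A] & [disjoint F2 & A]],
      F = F1 :|: F2 :|: A,
      interior sigma (F1 :|: A :|: E) & interior sigma (F2 :|: A :|: E)].

End Defs.

Definition infinite_type (T : eqType) : Prop := forall s : seq T, exists x, x \notin s.

(* Main.v *)
Require Import Defs.
From HB Require Import structures.
From mathcomp Require Import all_boot all_order all_algebra.
From mathcomp Require Import mpoly ssrcomplements.
From mathcomp Require Import zify ring.
Set Implicit Arguments. Unset Strict Implicit. Unset Printing Implicit Defensive.
Import Order.TTheory GRing.Theory Num.Theory.
Local Open Scope ring_scope.

(** Let [Delta] be the link of [E], and for a face [G] of it let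
    [tau G = V \ sigma (G :|: E)].  If the local face module vanishes and [M] is
    a face with [tau M] empty, then [x^M = \sum_j theta_j g_j] in [k[Delta]], and
    in fact [g_j] can be taken supported on faces [G] such that [theta_j] is
    [theta_v] for every [v] in [tau G].  This is the exactness of a subcomplex of
    the Koszul complex of [theta]; removing the elements of [V] one at a time
    reduces it to the acyclicity of the Koszul complexes of the rings
    [k[lk_(Gamma_U) E]], i.e. to Reisner's criterion.  The latter comes from the
    double complex Koszul (x) Cech: the Cech direction computes homology of links,
    and the Koszul direction is contractible once some [x_w] is inverted, as a
    power of [x_w] lies in the ideal of [theta].

    If [F] is not a U-pyramid, then [#|tau G| >= 2] for every subface [G] of [F]
    that misses an apex, so the coefficients of the [g_j] at subfaces of [F] live
    on faces [A_F :|: G] with [G \subset F1 :|: F2].  Hence, for the minimal [G]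
    with [tau (A_F :|: G)] empty, each generator [x^G] is a combination of the
    [theta_v x^H] with [tau (A_F :|: H) = [set v]].  Comparing
    coefficients rules out two disjoint such [G], one of which has at most two
    elements. *)

(** * Complexes with a distinguished basis *)

(** Ideals, quotients and localizations spanned by monomials are convex sets of cells of a single
    based complex, so each exact sequence is an inclusion of sets of cells and no module is formed.
    The vanishing of the local face module only supplies cofactors without a support condition; the
    obstruction to moving them into a smaller complex is the next homology of a quotient. This is
    why acyclicity is needed in all positive Koszul degrees, for every part of the l.s.o.p. left
    after removing some of the [theta_v]. The bound on [F1] serves the final comparison: the minimal
    set inside [F1] then has one or two elements, and a relation read at a pair has just two terms.
    When its right-hand side is 0, one nonzero term forces the other, so nonvanishing propagates
    along pairs from [F1] to the disjoint minimal set, where short cycles of pairs and exchanges of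
    vertices give the contradiction. *)

(* A complex is given by a basis [B]: [D] is the differential on functions
   [B -> k], [R x y] holds when the boundary at [y] may involve the value at [x],
   and the convex subsets of [B] carry the subquotient complexes. *)
Section BasedComplex.
Variables (k : zmodType) (B : Type) (D : (B -> k) -> B -> k).
Variables (R : B -> B -> Prop) (deg : B -> nat).
Hypothesis D_sub : forall f g b, D (fun x => f x - g x) b = D f b - D g b.
Hypothesis D_loc : forall f b, (forall x, R x b -> f x = 0) -> D f b = 0.
Hypothesis D_D : forall f b, D (D f) b = 0.
Hypothesis R_deg : forall x y, R x y -> deg x = (deg y).+1.

Definition supported (X : B -> bool) i (f : B -> k) :=
  forall b, f b != 0 -> X b /\ deg b = i.

Definition boundary (X : B -> bool) i (f : B -> k) :=
  exists2 g, supported X i.+1 g & forall b, X b -> D g b = f b.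

Definition acyclic (X : B -> bool) i :=
  forall f, supported X i f -> (forall b, X b -> D f b = 0) -> boundary X i f.

Definition convex (X : B -> bool) :=
  forall x y z, R x y -> R y z -> X x -> X z -> X y.

Definition restrict (X : B -> bool) (f : B -> k) b := if X b then f b else 0.

Lemma D_eq f g b : (forall x, R x b -> f x = g x) -> D f b = D g b.
Proof.
move=> fg; apply/eqP; rewrite -subr_eq0 -D_sub; apply/eqP/D_loc => x Rx.
by rewrite fg ?subrr.
Qed.

Lemma D_add f g b : D (fun x => f x + g x) b = D f b + D g b.
Proof.
have D0 x : D (fun=> 0) x = 0 by apply: D_loc.
rewrite (@D_eq (fun x => f x + g x) (fun x => f x - (0 - g x))); last first.
  by move=> x _; rewrite sub0r opprK.
by rewrite !D_sub D0 sub0r opprK.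
Qed.

Lemma supported0 X i f b : supported X i f -> ~~ X b -> f b = 0.
Proof. by move=> sf Xb; apply/eqP/idPn => /sf[]; rewrite (negPf Xb). Qed.

Lemma supported_deg X i f b : supported X i f -> deg b != i -> f b = 0.
Proof. by move=> sf Xb; apply/eqP/idPn => /sf[_ /eqP]; rewrite (negPf Xb). Qed.

Lemma D_deg X i f b : supported X i.+1 f -> D f b != 0 -> deg b = i.
Proof.
move=> sf; apply: contraNeq => degb; apply/eqP/D_loc => x /R_deg dx.
by apply: (supported_deg sf); rewrite dx.
Qed.

Section SubQuotient.
Variables X X1 : B -> bool.
Hypothesis cX : convex X.
Hypothesis X1X : forall b, X1 b -> X b.
(** Thus [X1] spans a subcomplex of the subquotient [X], and [X2] is the quotient. *)
Hypothesis X1_closed : forall x y, R x y -> X1 x -> X y -> X1 y.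
Let X2 b := X b && ~~ X1 b.

Lemma X2X b : X2 b -> X b. Proof. by case/andP. Qed.

Lemma D_sub_part i g b : supported X1 i g -> X2 b -> D g b = 0.
Proof.
move=> sg /andP[Xb X1b]; apply: D_loc => x Rxb; apply: (supported0 sg).
by apply: contra X1b => X1x; exact: X1_closed Rxb X1x Xb.
Qed.

Lemma D_quotient_part i g b :
  supported X i g -> X2 b -> D (restrict X2 g) b = D g b.
Proof.
move=> sg X2b; apply/eqP; rewrite -subr_eq0 -D_sub.
apply/eqP/D_loc => x Rxb; rewrite /restrict.
case: ifP => [|X2x]; first by rewrite subrr.
rewrite sub0r; apply/eqP; rewrite oppr_eq0; apply/eqP/(supported0 sg).
apply: contraFN X2x => Xx; rewrite /X2 Xx /=; case/andP: X2b => Xb.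
by apply: contra => X1x; exact: X1_closed Rxb X1x Xb.
Qed.

(** At a point outside [X] with an arrow to [X1], [D u] vanishes: an arrow into it from the support
    of [u] would, by convexity, put it in [X]. So truncating [f - D u] to [X1] loses nothing, and
    [D_D] applies. *)
Lemma D_correction i f u b : supported X i f -> supported X i.+1 u ->
    (forall b, X2 b -> f b = D u b) -> X1 b ->
  D (restrict X1 (fun x => f x - D u x)) b = D f b.
Proof.
move=> sf su fu X1b; rewrite -[RHS]subr0 -(D_D u b) -D_sub.
apply: D_eq => y Ryb; rewrite /restrict; case: ifP => // X1y.
have [Xy|Xy] := boolP (X y); first by rewrite fu ?subrr // /X2 Xy X1y.
rewrite (supported0 sf) // D_loc ?subrr // => x Rxy.
by apply: (supported0 su); apply: contra Xy => Xx; apply: cX Rxy Ryb Xx _; exact: X1X.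
Qed.

Lemma supported_correction i f u : supported X i f -> supported X i.+1 u ->
  supported X1 i (restrict X1 (fun x => f x - D u x)).
Proof.
move=> sf su b; rewrite /restrict; case: ifP => [X1b nz|]; last by rewrite eqxx.
split=> //; have [/eqP fb|/sf[]//] := boolP (f b == 0).
by move: nz; rewrite fb sub0r oppr_eq0 => /(D_deg su).
Qed.

Lemma supported_restrict (Y Z : B -> bool) i f :
  supported Y i f -> supported Z i (restrict Z f).
Proof.
by move=> sf b; rewrite /restrict; case: ifP => [Zb /sf[_ ->]|]; rewrite ?eqxx.
Qed.

Lemma supportedW (Y Z : B -> bool) i f :
  (forall b, Y b -> Z b) -> supported Y i f -> supported Z i f.
Proof. by move=> YZ sf b /sf[/YZ]. Qed.

(** Injectivity of H_i(X1) -> H_i(X): the part on [X2] of a bounding chain is a cycle there, hence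
    removable. *)
Lemma boundary_sub i f : acyclic X2 i.+1 ->
  supported X1 i f -> boundary X i f -> boundary X1 i f.
Proof.
move=> acX2 sf [g sg Dg].
have [|u su Du] := acX2 _ (supported_restrict sg).
  move=> b X2b; rewrite (D_quotient_part sg) // Dg ?X2X //.
  by case/andP: X2b => _; apply: (supported0 sf).
have su' := supportedW X2X su.
exists (restrict X1 (fun x => g x - D u x)); first exact: supported_correction.
move=> b X1b; rewrite (D_correction sg) ?Dg //; first exact: X1X.
by move=> c X2c; rewrite Du // /restrict X2c.
Qed.

Lemma acyclic_sub i : acyclic X i -> acyclic X2 i.+1 -> acyclic X1 i.
Proof.
move=> acX acX2 f sf Df; apply: boundary_sub => //.
apply: acX => [|b Xb]; first exact: supportedW sf.
have [/Df //|X1b] := boolP (X1 b).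
by apply: (D_sub_part sf); rewrite /X2 Xb.
Qed.

Lemma acyclic_extension i : acyclic X1 i -> acyclic X2 i -> acyclic X i.
Proof.
move=> acX1 acX2 f sf Df.
have [|u su Du] := acX2 _ (supported_restrict sf).
  by move=> b X2b; rewrite (D_quotient_part sf) // Df ?X2X.
have su' := supportedW X2X su.
have fu b : X2 b -> f b = D u b by move=> X2b; rewrite Du // /restrict X2b.
have [|g sg Dg] := acX1 _ (supported_correction sf su').
  by move=> b X1b; rewrite (D_correction sf) ?Df //; apply: X1X.
exists (fun x => u x + g x).
  move=> b; have [/eqP->|/su[/X2X]//] := boolP (u b == 0).
  by rewrite add0r => /sg[/X1X].
move=> b Xb; rewrite D_add; have [X1b|X1b] := boolP (X1 b).
  by rewrite Dg // /restrict X1b addrC subrK.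
have X2b : X2 b by rewrite /X2 Xb.
by rewrite -fu // (D_sub_part sg) // addr0.
Qed.

(** The connecting map: seen in [X], the boundary of a cycle of [X2] lies on [X1], where it bounds;
    correcting by the bounding chain gives a cycle of [X]. *)
Lemma acyclic_quotient i : acyclic X i.+1 -> acyclic X1 i -> acyclic X2 i.+1.
Proof.
move=> acX acX1 f sf Df; have sf' := supportedW X2X sf.
(* Correcting the zero chain by [u := f] is a way to put minus the boundary of [f] on [X1]. *)
have s0 : supported X i (fun=> 0) by move=> b; rewrite eqxx.
have sg0 : supported X1 i (restrict X1 (fun x => 0 - D f x)).
  exact: supported_correction.
have [|g sg Dg] := acX1 _ sg0.
  move=> b X1b; rewrite (D_correction s0) //; first exact: D_loc.
  by move=> c X2c; rewrite Df.
have [||u su Du] := acX (fun x => f x + g x).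
- move=> b; have [/eqP->|/sf'//] := boolP (f b == 0).
  by rewrite add0r => /sg[/X1X].
- move=> b Xb; rewrite D_add; have [X1b|X1b] := boolP (X1 b).
    by rewrite Dg // /restrict X1b sub0r addrN.
  by rewrite Df ?(D_sub_part sg) ?addr0 // /X2 Xb X1b.
exists (restrict X2 u); first exact: supported_restrict su.
move=> b X2b; rewrite (D_quotient_part su) // Du ?X2X //.
by rewrite (supported0 sg) ?addr0 //; case/andP: X2b.
Qed.

End SubQuotient.

Lemma acyclic_ext (X Y : B -> bool) i : X =1 Y -> acyclic X i -> acyclic Y i.
Proof.
move=> XY acX f sf Df; have [||g sg Dg] := acX f.
- by move=> b /sf; rewrite XY.
- by move=> b; rewrite XY => /Df.
by exists g => [b /sg|b]; rewrite -XY //; apply: Dg.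
Qed.

(** Arrows do not lower [l], so the sets [N - m <= l] filter [X] by subcomplexes, with single layers
    as successive quotients. *)
Lemma acyclic_layers (X : B -> bool) (l : B -> nat) N i : convex X ->
    (forall x y, R x y -> X x -> X y -> (l x <= l y)%N) ->
    (forall x, X x -> (l x < N)%N) ->
    (forall m : nat, acyclic (fun b => X b && (l b == m)) i) ->
  acyclic X i.
Proof.
move=> cX lR lN ac.
suff acm m : (m <= N)%N -> acyclic (fun b => X b && (N - m <= l b)%N) i.
  by apply: acyclic_ext (acm N (leqnn _)) => b; rewrite subnn leq0n andbT.
elim: m => [|m IHm] mN.
  move=> f sf _; exists (fun=> 0) => [b|b /andP[/lN]]; first by rewrite eqxx.
  by rewrite subn0 ltnNge => /negPf ->.
have {}IHm := IHm (ltnW mN).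
apply: (acyclic_extension _ _ _ IHm) => [x y z Rxy Ryz||x y|].
- move=> /andP[Xx lx] /andP[Xz lz]; have Xy := cX _ _ _ Rxy Ryz Xx Xz.
  by rewrite Xy (leq_trans lx) // lR.
- by move=> b /andP[-> lb]; rewrite (leq_trans _ lb) // leq_sub2l.
- move=> Rxy /andP[Xx lx] /andP[Xy ly].
  by rewrite Xy (leq_trans lx) ?lR.
apply: acyclic_ext (ac (N - m.+1)%N) => b /=; case: (X b) => //=; lia.
Qed.

End BasedComplex.

(** * Koszul and Cech differentials *)

Section Signs.
Variable k : fieldType.

Definition sgn m (A : {set 'I_m}) (j : 'I_m) : k :=
  (-1) ^+ #|[set u in A | (u < j)%N]|.

Lemma sgnU m (A : {set 'I_m}) i j : i \notin A ->
  sgn (i |: A) j = (-1) ^+ (i < j)%N * sgn A j.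
Proof.
move=> iA; rewrite /sgn -exprD; congr (_ ^+ _).
have [ij|ij] := boolP (i < j)%N.
  have -> : [set u in i |: A | (u < j)%N] = i |: [set u in A | (u < j)%N].
    by apply/setP => u; rewrite !inE; case: eqVneq => // ->.
  by rewrite cardsU1 !inE (negPf iA).
rewrite add0n; apply: eq_card => u; rewrite !inE.
by case: eqVneq => //= ->; rewrite (negPf ij) andbF.
Qed.

Lemma sgn_sqr m (A : {set 'I_m}) j : sgn A j * sgn A j = 1.
Proof. by rewrite /sgn -expr2 sqrr_sign. Qed.

Lemma sgn_self m (A : {set 'I_m}) j : sgn (j |: A) j = sgn A j.
Proof.
have [jA|jA] := boolP (j \in A); first by rewrite (setUidPr _) // sub1set.
by rewrite sgnU // ltnn mul1r.
Qed.

Lemma sgn_selfD m (A : {set 'I_m}) j : sgn (A :\ j) j = sgn A j.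
Proof.
have [jA|jA] := boolP (j \in A); first by rewrite -sgn_self setD1K.
by congr (sgn _ _); apply/setDidPl; rewrite disjoint_sym disjoints1.
Qed.

Lemma sgn_swap m (A : {set 'I_m}) i j : i != j -> i \notin A -> j \notin A ->
  sgn A i * sgn (i |: A) j + sgn A j * sgn (j |: A) i = 0.
Proof.
move=> ij iA jA; rewrite !sgnU //.
case: (ltngtP i j) ij => [||/val_inj->]; last by rewrite eqxx.
  by rewrite expr1 expr0 => *; ring.
by rewrite expr1 expr0 => *; ring.
Qed.

Lemma sgn_swapD m (A : {set 'I_m}) i j : i != j -> i \in A -> j \in A ->
  sgn A i * sgn (A :\ i) j + sgn A j * sgn (A :\ j) i = 0.
Proof.
move=> ij iA jA; rewrite -(@sgn_swap _ (A :\ i :\ j) i j) ?inE ?eqxx ?ij ?andbF //.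
rewrite -[sgn A i]sgn_selfD -[sgn A j]sgn_selfD.
rewrite (_ : i |: (_ :\ _) = A :\ j); last first.
  by apply/setP => u; rewrite !inE; case: (u =P i) => // ->; rewrite ij iA.
rewrite (_ : j |: (_ :\ _) = A :\ i); last first.
  by apply/setP => u; rewrite !inE; case: (u =P j) => // ->; rewrite eq_sym ij jA.
have := @sgn_selfD _ (A :\ i) j; have := @sgn_selfD _ (A :\ j) i.
by rewrite (setDDl A [set i]) (setDDl A [set j]) setUC => -> ->; ring.
Qed.

(** Terms are cancelled in pairs [(i, j)], [(j, i)] without dividing by 2, so the squares of the
    differentials vanish in every characteristic. *)
Lemma sum_antisym m (C : pred 'I_m) (g : 'I_m -> 'I_m -> k) :
    (forall i j, i != j -> C i -> C j -> g i j + g j i = 0) ->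
  \sum_(i | C i) \sum_(j | C j && (j != i)) g i j = 0.
Proof.
move=> gN.
transitivity (\sum_(i | C i) (\sum_(j | C j && (j < i)%N) g i j
                     + \sum_(j | C j && (i < j)%N) g i j)).
  apply: eq_bigr => i Ci.
  rewrite (bigID (fun j : 'I_m => j < i)%N) /=; congr (_ + _); apply: eq_bigl => j.
    by rewrite -andbA; congr (_ && _); rewrite andbC neq_ltn; case: ltngtP.
  by rewrite -andbA; congr (_ && _); rewrite -val_eqE /=; case: ltngtP.
rewrite big_split /= (exchange_big_dep C) /=; last by move=> i j _ /andP[].
rewrite -big_split /= big1 // => i Ci; rewrite (eq_bigl (fun j => C j && (i < j)%N)).
  rewrite -big_split big1 //= => j /andP[Cj ij]; apply: gN => //.
  by rewrite -val_eqE neq_ltn ij orbT.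
by move=> j; rewrite Ci.
Qed.

Definition cob n (phi : {set 'I_n} -> k) (F : {set 'I_n}) : k :=
  \sum_(w in F) sgn F w * phi (F :\ w).

Lemma cob_cob n (phi : {set 'I_n} -> k) F : cob (cob phi) F = 0.
Proof.
pose g w u := sgn F w * sgn (F :\ w) u * phi (F :\ w :\ u).
rewrite /cob -[RHS](@sum_antisym _ [pred w | w \in F] g) /=.
  apply: eq_bigr => w wF; rewrite mulr_sumr; apply: eq_big => [u|u _].
    by rewrite !inE andbC.
  by rewrite mulrA.
move=> w u wu wF uF; rewrite /g.
by rewrite [F :\ u :\ w]setDDl setUC -setDDl -mulrDl sgn_swapD // mul0r.
Qed.

Lemma eq_cob n (phi psi : {set 'I_n} -> k) (F : {set 'I_n}) :
  (forall w, w \in F -> phi (F :\ w) = psi (F :\ w)) -> cob phi F = cob psi F.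
Proof. by move=> e; apply: eq_bigr => w /e ->. Qed.

End Signs.

Section KoszulCech.
Variables (k : fieldType) (n d : nat) (t : 'I_d -> 'I_n -> k).

Notation expo := {ffun 'I_n -> int}.
Notation cell := ({set 'I_d} * {set 'I_n} * {ffun 'I_n -> int})%type.
Notation chain := ({set 'I_d} * {set 'I_n} * {ffun 'I_n -> int} -> k).

(* In a cell [(A, F, a)], [A] is the exterior part of the Koszul complex, [F] says
   that [x^F] is inverted and [a] is the exponent of a Laurent monomial.  Chains
   are arbitrary functions on cells: no finiteness of the support is needed. *)
Definition evec (w : 'I_n) : expo := [ffun u => (u == w)%:Z].

Definition kosz (f : chain) : chain := fun b =>
  \sum_(j | j \notin b.1.1) sgn k b.1.1 j *
    \sum_w t j w * f (j |: b.1.1, b.1.2, b.2 - evec w).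

Definition cech (f : chain) : chain := fun b =>
  cob (fun F => f (b.1.1, F, b.2)) b.1.2.

Definition diff (f : chain) : chain := fun b =>
  kosz f b + (-1) ^+ #|b.1.1| * cech f b.

Definition arrow (x y : cell) : Prop :=
  (exists2 j, j \notin y.1.1 & exists2 w, t j w != 0 &
     x = (j |: y.1.1, y.1.2, y.2 - evec w)) \/
  (exists2 w, w \in y.1.2 & x = (y.1.1, y.1.2 :\ w, y.2)).

(** The Cech differential enlarges [F], so its degree counts the vertices missing from [F]. Koszul
    degree p at [F = set0] is total degree [n + p], hence the bounds [n < i] below. *)
Definition cdeg (b : cell) : nat := (#|b.1.1| + (n - #|b.1.2|))%N.

Lemma arrow_cdeg x y : arrow x y -> cdeg x = (cdeg y).+1.
Proof.
case: y => [[A F] a] []/= [].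
  by move=> j jA [w _ ->]; rewrite /cdeg /= cardsU1 jA.
move=> w wF ->; rewrite /cdeg /= -addnS; congr addn.
have: (#|F| <= n)%N by rewrite -[leqRHS]card_ord max_card.
by rewrite (cardsD1 w F) wF /= add1n => Fn; rewrite subnSK.
Qed.

Lemma kosz_sub (f g : chain) b : kosz (fun x => f x - g x) b = kosz f b - kosz g b.
Proof.
rewrite -sumrB; apply: eq_bigr => j _; rewrite -mulrBr -sumrB; congr (_ * _).
by apply: eq_bigr => w _; rewrite mulrBr.
Qed.

Lemma cech_sub (f g : chain) b : cech (fun x => f x - g x) b = cech f b - cech g b.
Proof. by rewrite -sumrB; apply: eq_bigr => j _; rewrite mulrBr. Qed.

Lemma diff_sub (f g : chain) b : diff (fun x => f x - g x) b = diff f b - diff g b.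
Proof. by rewrite /diff kosz_sub cech_sub; ring. Qed.

Lemma kosz_loc (f : chain) (b : cell) : (forall j w, j \notin b.1.1 -> t j w != 0 ->
  f (j |: b.1.1, b.1.2, b.2 - evec w) = 0) -> kosz f b = 0.
Proof.
move=> f0; apply: big1 => j jA; rewrite big1 ?mulr0 // => w _.
by have [->|/f0->//] := eqVneq (t j w) 0; rewrite ?mul0r ?mulr0.
Qed.

Lemma diff_loc f b : (forall x, arrow x b -> f x = 0) -> diff f b = 0.
Proof.
move=> f0; rewrite /diff kosz_loc => [|j w jA tw]; last first.
  by apply: f0; left; exists j => //; exists w.
rewrite /cech /cob big1 ?mulr0 ?addr0 // => w wF.
by rewrite f0 ?mulr0 //; right; exists w.
Qed.

Lemma kosz_kosz f b : kosz (kosz f) b = 0.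
Proof.
case: b => [[A F] a]; rewrite /kosz /=.
pose g j i := sgn k A j * sgn k (j |: A) i *
  \sum_w \sum_u t j w * t i u * f (i |: (j |: A), F, a - evec w - evec u).
rewrite -[RHS](@sum_antisym k _ [pred j | j \notin A] g) /=.
  apply: eq_bigr => j jA; under [RHS]eq_bigr do rewrite /g -mulrA.
    rewrite -mulr_sumr; congr (_ * _).
  under eq_bigr do rewrite mulr_sumr.
  rewrite exchange_big /=; apply: eq_big => [i|i _].
    by rewrite !inE negb_or andbC.
  rewrite mulr_sumr; apply: eq_bigr => w _; rewrite mulrCA mulr_sumr.
  by congr (_ * _); apply: eq_bigr => u _; rewrite mulrA.
move=> j i ji jA iA; rewrite /g.
rewrite [in X in _ + X]exchange_big /=.
under [in X in _ + X]eq_bigr do under eq_bigr do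
  rewrite [t i _ * _]mulrC setUCA addrAC.
by rewrite -mulrDl sgn_swap // mul0r.
Qed.

Lemma cech_cech f b : cech (cech f) b = 0.
Proof. exact: (cob_cob (fun F => f (b.1.1, F, b.2))). Qed.

Lemma kosz_cech f b : kosz (cech f) b = cech (kosz f) b.
Proof.
case: b => [[A F] a]; rewrite /kosz /cech /cob /=.
under [RHS]eq_bigr do rewrite mulr_sumr.
rewrite [RHS]exchange_big /=; apply: eq_bigr => j jA.
under eq_bigr do rewrite mulr_sumr.
rewrite exchange_big mulr_sumr; apply: eq_bigr => w wF.
by rewrite !mulr_sumr; apply: eq_bigr => u _; ring.
Qed.

Lemma diff_diff f b : diff (diff f) b = 0.
Proof.
rewrite /diff.
pose s (g : chain) : chain := fun x => (-1) ^+ #|x.1.1| * g x.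
have kN g h : kosz (fun x => g x + h x) b = kosz g b + kosz h b.
  rewrite /kosz -big_split; apply: eq_bigr => j _ /=.
  by rewrite -mulrDr -big_split; congr (_ * _); apply: eq_bigr => w _; rewrite mulrDr.
have cN g h : cech (fun x => g x + h x) b = cech g b + cech h b.
  by rewrite /cech /cob -big_split; apply: eq_bigr => j _ /=; rewrite mulrDr.
have ks g : kosz (s g) b = - s (kosz g) b.
  rewrite /s /kosz mulr_sumr -sumrN; apply: eq_bigr => j jA.
  rewrite /= cardsU1 jA mulrCA -mulrN; congr (_ * _).
  by rewrite mulr_sumr -sumrN; apply: eq_bigr => w _; rewrite exprS; ring.
have cs g : cech (s g) b = s (cech g) b.
  by rewrite /s /cech /cob mulr_sumr; apply: eq_bigr => w _; rewrite mulrCA.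
rewrite kN cN (ks (cech f)) (cs (cech f)) kosz_kosz {1}/s {1}/s kosz_cech cech_cech.
by ring.
Qed.

End KoszulCech.

(** * Exactness of cochains from Betti numbers *)

Section LinkExactness.
Variables (k : fieldType) (n : nat).
Implicit Types (D : {set {set 'I_n}}) (phi : {set 'I_n} -> k).

Let colv phi : 'cV[k]_#|{set 'I_n}| := \col_i phi (enum_val i).

Lemma bd_colv D s phi i : (bd k D s *m colv phi) i 0 =
  if (enum_val i \in D) && (#|enum_val i| == s) then cob phi (enum_val i) else 0.
Proof.
rewrite mxE; case: ifP => Ds; last first.
  by apply: big1 => j _; rewrite !mxE /= Ds mul0r.
under eq_bigr do rewrite !mxE /= Ds mulr_suml.
rewrite exchange_big; apply: eq_bigr => w _ /=.
rewrite (bigD1 (enum_rank (enum_val i :\ w))) //= enum_rankK eqxx big1 ?addr0 //.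
move=> j ne; case: eqP => [e|]; last by rewrite mul0r.
by case/eqP: ne; rewrite -e enum_valK.
Qed.

Lemma bd_bd D s : is_complex D -> bd k D s.+1 *m bd k D s = 0.
Proof.
move=> [_ cD]; apply/matrixP => i j.
pose phi F : k := (F == enum_val j)%:R.
have phiE : colv phi = delta_mx j 0.
  by apply/matrixP => a b; rewrite !mxE ord1 eqxx andbT /phi (inj_eq enum_val_inj).
transitivity ((bd k D s.+1 *m bd k D s *m delta_mx j 0) i (0 : 'I_1)).
  by rewrite -colE [RHS]mxE.
rewrite -phiE -mulmxA [RHS]mxE.
pose psi F := if (F \in D) && (#|F| == s) then cob phi F else 0.
have -> : bd k D s *m colv phi = colv psi.
  by apply/matrixP => a b; rewrite ord1 bd_colv mxE.
rewrite bd_colv; case: ifP => // /andP[FD /eqP Fs].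
rewrite -[RHS](cob_cob phi (enum_val i)); apply: eq_cob => w wF.
rewrite /psi (cD _ _ FD) ?subsetDl //=.
by move: Fs; rewrite (cardsD1 w) wF add1n => -[->]; rewrite eqxx.
Qed.

(** [rbetti] counts ranks of boundary maps; transposing keeps the ranks, so vanishing homology makes
    the cochains exact. *)
Lemma rbetti_exact D s phi : is_complex D -> rbetti k D s = 0%N ->
    (forall F, phi F != 0 -> F \in D /\ #|F| = s) ->
    (forall F, F \in D -> #|F| = s.+1 -> cob phi F = 0) ->
  exists2 psi : {ffun {set 'I_n} -> k},
    (forall F, psi F != 0 -> F \in D /\ #|F|.+1 = s) &
    (forall F, F \in D -> #|F| = s -> cob psi F = phi F).
Proof.
move=> cD rb sphi dphi; pose N := #|{set 'I_n}|.
pose S := [set F in D | #|F| == s].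
pose P : 'M[k]_(#|S|, N) := \matrix_(i, j) (enum_val i == enum_val j)%:R.
have PPT : P *m P^T = 1%:M.
  apply/matrixP => i j; rewrite !mxE (bigD1 (enum_rank (enum_val i))) //= !mxE.
  rewrite enum_rankK eqxx mul1r big1 ?addr0 => [|a ne].
    by rewrite (inj_eq enum_val_inj) eq_sym.
  rewrite !mxE; case: eqP => [e|]; last by rewrite mul0r.
  by case/eqP: ne; rewrite e enum_valK.
have rankP : \rank P = #|S|.
  by apply/eqP; change (row_free P); apply/row_freeP; exists P^T.
have XPP m (X : 'M[k]_(m, N)) :
    (forall i j, X i j != 0 -> enum_val j \in S) -> X *m P^T *m P = X.
  move=> XS; apply/matrixP => i j; rewrite -mulmxA.
  have -> : P^T *m P = \matrix_(a, b) ((a == b) && (enum_val b \in S))%:R.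
    apply/matrixP => a b; rewrite !mxE.
    have [bS|bS] := boolP (enum_val b \in S); last first.
      rewrite andbF big1 // => c _; rewrite !mxE.
      case: (enum_val c =P enum_val b) => [e|]; last by rewrite mulr0.
      by rewrite -e enum_valP in bS.
    rewrite (bigD1 (enum_rank_in bS (enum_val b))) //= !mxE !enum_rankK_in //.
    rewrite eqxx mulr1 andbT (inj_eq enum_val_inj) eq_sym big1 ?addr0 //.
    move=> c ne; rewrite !mxE; case: (enum_val c =P enum_val b) => [e|].
      by case/eqP: ne; apply: enum_val_inj; rewrite e enum_rankK_in.
    by rewrite mulr0.
  rewrite !mxE (bigD1 j) //= mxE eqxx big1 ?addr0 => [|a ne]; last first.
    by rewrite mxE (negPf ne) mulr0.
  have [->|/XS->] := eqVneq (X i j) 0; first by rewrite mul0r.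
  by rewrite mulr1.
(* Rows are cochains: [B] and [C] are the coboundaries out of and into size [s], and [P] spans the
   cochains on faces of size [s]. *)
set B := (bd k D s.+1)^T; set C := (bd k D s)^T.
have BS : (bd k D s.+1) *m P^T *m P = bd k D s.+1.
  apply: XPP => i j; rewrite mxE /=; case: ifP => [/andP[FD /eqP Fs]|]; last by rewrite eqxx.
  apply: contraNT => jS; rewrite big1 // => w wF; case: eqP => // e.
  case/negP: jS; rewrite e inE (cD.2 _ _ FD) ?subsetDl //=.
  by move: Fs; rewrite (cardsD1 w) wF add1n => -[->]; rewrite eqxx.
have CS : C *m P^T *m P = C.
  apply: XPP => i j; rewrite !mxE /= inE; case: ifP => //.
  by rewrite eqxx.
have CsubP : (C <= P :&: kermx B)%MS.
  rewrite sub_capmx -{1}CS submxMl /=; apply/sub_kermxP.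
  by rewrite -trmx_mul bd_bd ?trmx0.
have rkB : (\rank B <= \rank (P *m B))%N.
  by rewrite -{1}[B]trmxK trmxK /B -{1}BS !trmx_mul trmxK mxrankM_maxr.
have PBC : (P :&: kermx B <= C)%MS.
  rewrite -(mxrank_leqif_sup CsubP) eqn_leq (mxrankS CsubP) /=.
  (* Rank-nullity on the row space of [P]; the truncated subtraction in [rb] is read as [cdim D s <=
     \rank (bd k D s) + \rank (bd k D s.+1)]. *)
  have := mxrank_mul_ker P B; rewrite rankP.
  move: rb; rewrite /rbetti /cdim -/S mxrank_tr => /eqP.
  move: rkB; rewrite /B mxrank_tr => rkB; rewrite -subnDA subn_eq0.
  move=> h1 h2; rewrite -(leq_add2l (\rank (P *m (bd k D s.+1)^T))) h2.
  by rewrite (leq_trans h1) // addnC leq_add2r.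
have phiC : ((colv phi)^T <= C)%MS.
  apply: submx_trans PBC; rewrite sub_capmx; apply/andP; split.
    have <- : (colv phi)^T *m P^T *m P = (colv phi)^T.
      by apply: XPP => i j; rewrite !mxE => /sphi[FD Fs]; rewrite inE FD Fs eqxx.
    exact: submxMl.
  apply/sub_kermxP; rewrite -trmx_mul; apply/matrixP => a b; rewrite !mxE ord1.
  have := bd_colv D s.+1 phi b; rewrite mxE => ->.
  by case: ifP => // /andP[FD /eqP]; apply: dphi.
case/submxP: phiC => v phiv.
pose psi := [ffun F => if (F \in D) && (#|F|.+1 == s) then v 0 (enum_rank F) else 0].
exists psi => [F|F FD Fs].
  by rewrite ffunE; case: ifP => [/andP[-> /eqP]|]; rewrite ?eqxx.
have /matrixP/(_ (enum_rank F) 0) : colv phi = bd k D s *m v^T.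
  by rewrite -[LHS]trmxK phiv trmx_mul trmxK.
have -> : v^T = colv (fun G => v 0 (enum_rank G)).
  by apply/matrixP => i j; rewrite !mxE ord1 enum_valK.
rewrite bd_colv enum_rankK FD Fs eqxx /= mxE enum_rankK => ->.
apply: eq_cob => w wF; rewrite ffunE (cD.2 _ _ FD) ?subsetDl //=.
by move: Fs; rewrite (cardsD1 w) wF add1n => ->; rewrite eqxx.
Qed.

End LinkExactness.

(** * Cech complexes of face rings in a fixed multidegree *)

Section CechExactness.
Variables (k : fieldType) (n : nat).

Definition posx (a : {ffun 'I_n -> int}) := [set w | 0 < a w].
Definition negx (a : {ffun 'I_n -> int}) := [set w | a w < 0].

Lemma sgn_disjointU (F G : {set 'I_n}) w : [disjoint F & G] ->
  sgn k (F :|: G) w = sgn k F w * sgn k G w.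
Proof.
move=> FG; rewrite /sgn -exprD; congr (_ ^+ _).
have -> : [set u in F :|: G | (u < w)%N] =
    [set u in F | (u < w)%N] :|: [set u in G | (u < w)%N].
  by apply/setP => u; rewrite !inE andb_orl.
rewrite cardsU (_ : _ :&: _ = set0) ?cards0 ?subn0 //.
apply/setP => u; rewrite !inE; apply/negP => /andP[/andP[uF _] /andP[uG _]].
by move/pred0P: FG => /(_ u) /=; rewrite uF uG.
Qed.

(** Contraction of a cone with apex [w]: the cocycle condition at [w |: F] settles the faces [F]
    without [w]. *)
Lemma cob_cone (w : 'I_n) (phi : {set 'I_n} -> k) (F : {set 'I_n}) :
    (w \notin F -> cob phi (w |: F) = 0) ->
  cob (fun H => if w \in H then 0 else sgn k H w * phi (w |: H)) F = phi F.
Proof.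
move=> cphi; have [wF|wF] := boolP (w \in F).
  rewrite /cob (bigD1 w) //= !inE eqxx /= setD1K // sgn_selfD mulrA sgn_sqr mul1r.
  rewrite big1 ?addr0 // => u /andP[uF uw].
  by rewrite !inE eq_sym uw wF /= mulr0.
have := cphi wF; rewrite /cob (bigD1 w) ?setU11 //= setU1K // sgn_self => e.
have {e} : sgn k F w * sgn k F w * phi F = - (sgn k F w * \sum_(i | (i \in w |: F) && (i != w))
  sgn k (w |: F) i * phi ((w |: F) :\ i)).
  by rewrite -mulrN -mulrA; congr (_ * _); apply/eqP; rewrite -addr_eq0; apply/eqP.
rewrite sgn_sqr mul1r => ->; rewrite mulr_sumr -sumrN; apply: eq_big => [u|u uF].
  by rewrite !inE; case: eqVneq => [->|]; rewrite ?(negPf wF) ?andbT.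
have uw : u != w by apply: contraNneq wF => <-.
rewrite !inE (negPf wF) andbF.
have -> : (w |: F) :\ u = w |: (F :\ u).
  by apply/setP => v; rewrite !inE; case: (v =P w) => // ->; rewrite eq_sym uw.
have := @sgn_swapD k _ (w |: F) w u; rewrite eq_sym uw setU11 !inE uF orbT.
move=> /(_ isT isT isT); rewrite setU1K // sgn_self.
have -> : (w |: F) :\ u = w |: (F :\ u).
  by apply/setP => v; rewrite !inE; case: (v =P w) => // ->; rewrite eq_sym uw.
rewrite sgn_self => e.
have {}e : sgn k F w * sgn k F u = - (sgn k (w |: F) u * sgn k (F :\ u) w).
  by apply/eqP; rewrite -addr_eq0; apply/eqP.
have ss := sgn_sqr k (F :\ u) w; have ss' := sgn_sqr k F w.
rewrite mulrA [sgn k F w * _]mulrA -mulNr; congr (_ * _).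
transitivity (sgn k F w * (sgn k F w * sgn k F u) * sgn k (F :\ u) w).
  by rewrite mulrA ss' mul1r.
by rewrite e mulrN mulNr -!mulrA ss mulr1.
Qed.

(** The sign by which adding [G] to the faces of its link commutes with [cob]. *)
Definition twist (G F : {set 'I_n}) : k := \prod_(w in F) sgn k G w.

Lemma twist_sqr G F : twist G F * twist G F = 1.
Proof. by rewrite -big_split big1 //= => w _; rewrite sgn_sqr. Qed.

Lemma cob_twist (G : {set 'I_n}) (chi : {set 'I_n} -> k) (F : {set 'I_n}) :
    (forall H : {set 'I_n}, ~~ (G \subset H) -> chi H = 0) -> [disjoint F & G] ->
  cob (fun H => twist G H * chi (H :|: G)) F = twist G F * cob chi (F :|: G).
Proof.
move=> chi0 FG; rewrite /cob mulr_sumr.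
rewrite [RHS](bigID (mem G)) /= [X in X + _]big1 ?add0r => [|w /andP[_ wG]]; last first.
  rewrite chi0 ?mulr0 //; apply/negP => /subsetP/(_ w wG).
  by rewrite !inE eqxx.
apply: eq_big => [w|w wF].
  rewrite !inE; case wG: (w \in G); rewrite ?orbF ?andbT ?orbT //.
  by apply/negP => wF; move/pred0P: FG => /(_ w) /=; rewrite wF wG.
have wG : w \notin G.
  by apply/negP => wG; move/pred0P: FG => /(_ w) /=; rewrite wF wG.
have -> : (F :|: G) :\ w = F :\ w :|: G.
  by apply/setP => u; rewrite !inE; case: (u =P w) => // ->; rewrite (negPf wG).
rewrite sgn_disjointU // /twist [in RHS](bigD1 w) //=.
under [X in _ = _ * X * _]eq_bigl do rewrite andbC -in_setD1.
have e : sgn k F w = sgn k G w * (sgn k F w * sgn k G w).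
  by rewrite mulrCA sgn_sqr mulr1.
by rewrite {1}e; ring.
Qed.

Variables (Delta : {set {set 'I_n}}) (delta : nat).
Hypothesis complexD : is_complex Delta.
Hypothesis link_acyclic : forall (G : {set 'I_n}) (s : nat), G \in Delta ->
  (s + #|G| < delta)%N -> rbetti k (link Delta G) s = 0%N.

(* [x^a] is a nonzero monomial of [k[Delta]] localized at [x^F]. *)
Definition allowed (a : {ffun 'I_n -> int}) (F : {set 'I_n}) :=
  (negx a \subset F) && (posx a :|: F \in Delta).

Lemma link_complex G : G \in Delta -> is_complex (link Delta G).
Proof.
case: complexD => D0 cD GD; split; first by rewrite inE D0 set0U GD -setI_eq0 set0I eqxx.
move=> F H; rewrite !inE => /and3P[FD dFG FGD] HF.
by rewrite (cD _ _ FD HF) (disjointWl HF dFG) (cD _ _ FGD) // setSU.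
Qed.

(** Hochster's computation. If some [a w] is positive, the allowed faces form a cone with apex [w];
    otherwise they are the faces containing [negx a], that is, the link of [negx a] shifted by its
    size. *)
Lemma cech_exact a p (phi : {set 'I_n} -> k) : (p < delta)%N ->
    (forall F, phi F != 0 -> allowed a F /\ #|F| = p) ->
    (forall F, allowed a F -> cob phi F = 0) ->
  exists psi : {ffun {set 'I_n} -> k},
    (forall F, psi F != 0 -> allowed a F /\ #|F|.+1 = p) /\
    (forall F, allowed a F -> cob psi F = phi F).
Proof.
case: (complexD) => _ cD pd sphi cphi.
have [pos0|[w wa]] := set_0Vmem (posx a); last first.
  exists [ffun H : {set 'I_n} => if w \in H then 0 else sgn k H w * phi (w |: H)].
  split=> [F|F aF].
    rewrite ffunE; case: ifP => wF; first by rewrite eqxx.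
    rewrite mulf_eq0 negb_or => /andP[_ /sphi[aw <-]]; split; last by rewrite cardsU1 wF.
    case/andP: aw => /subsetP nwF pwF; apply/andP; split.
      apply/subsetP => u ua; have := nwF _ ua; rewrite !inE => /orP[/eqP uw|//].
      by move: ua wa; rewrite uw !inE => /lt_trans h/h; rewrite ltxx.
    by apply: cD pwF _; rewrite setUS // subsetUr.
  rewrite (_ : cob _ F = cob (fun H => if w \in H then 0 else sgn k H w * phi (w |: H)) F).
    apply: cob_cone => wF; apply: cphi; case/andP: aF => nF pF; apply/andP; split.
      by apply: subset_trans nF _; rewrite subsetUr.
    by rewrite setUA (_ : posx a :|: [set w] = posx a) //; apply/setUidPl; rewrite sub1set.
  by apply: eq_cob => u _; rewrite ffunE.
have aE F : allowed a F = (negx a \subset F) && (F \in Delta).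
  by rewrite /allowed pos0 set0U.
set G := negx a in aE; have [GD|GD] := boolP (G \in Delta); last first.
  exists [ffun=> 0]; split=> F; first by rewrite ffunE eqxx.
  rewrite aE => /andP[GF FD]; case/negP: GD; exact: cD FD GF.
have [pG|Gp] := ltnP p #|G|.
  exists [ffun=> 0]; split=> F; first by rewrite ffunE eqxx.
  move=> aF; rewrite /cob big1 => [|w _]; last by rewrite ffunE mulr0.
  apply/esym/eqP; apply: contraLR pG => /sphi[]; rewrite aE => /andP[GF _] <-.
  by rewrite -leqNgt subset_leq_card.
have chi0 (H : {set 'I_n}) : ~~ (G \subset H) -> phi H = 0.
  by move=> GH; apply/eqP; apply: contraNT GH => /sphi[]; rewrite aE => /andP[].
pose phi' (F : {set 'I_n}) := if [disjoint F & G] then twist G F * phi (F :|: G) else 0.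
have cobphi' (F : {set 'I_n}) : [disjoint F & G] -> cob phi' F = twist G F * cob phi (F :|: G).
  move=> FG; rewrite -cob_twist //; apply: eq_cob => w _.
  by rewrite /phi' (disjointWl _ FG) // subsetDl.
have dUG (F : {set 'I_n}) : [disjoint F & G] -> #|F :|: G| = (#|F| + #|G|)%N.
  by move=> FG; rewrite cardsU (_ : F :&: G = set0) ?cards0 ?subn0 //; apply/eqP; rewrite setI_eq0.
have [||||psi spsi cpsi] := @rbetti_exact k n (link Delta G) (p - #|G|) phi'.
- exact: link_complex.
- by apply: link_acyclic => //; rewrite subnK.
- move=> F; rewrite /phi'; case: ifP => [FG|]; last by rewrite eqxx.
  rewrite mulf_eq0 negb_or => /andP[_ /sphi[]]; rewrite aE => /andP[_ FGD].
  by rewrite dUG // => <-; rewrite addnK inE FG FGD (cD _ _ FGD) ?subsetUl.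
- move=> F; rewrite inE => /and3P[FD FG FGD] _.
  by rewrite cobphi' // cphi ?mulr0 // aE FGD subsetUr.
exists [ffun F : {set 'I_n} => if G \subset F then twist G (F :\: G) * psi (F :\: G) else 0].
split=> [F|F].
  rewrite ffunE; case: ifP => [GF|]; last by rewrite eqxx.
  rewrite mulf_eq0 negb_or => /andP[_ /spsi[]]; rewrite inE => /and3P[_ FG].
  have FE : F :\: G :|: G = F by rewrite setUC -{1}(setIidPr GF) setID.
  rewrite FE => FD sz; rewrite aE GF FD; split=> //.
  by rewrite -FE dUG // -addSn sz subnK.
rewrite aE => /andP[GF FD].
have FE : F :\: G :|: G = F by rewrite setUC -{1}(setIidPr GF) setID.
have FG : [disjoint F :\: G & G] by rewrite -setI_eq0 setIDAC -setIDA setDv setI0.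
have lF : F :\: G \in link Delta G by rewrite inE FE FD FG (cD _ _ FD) ?subsetDl.
rewrite -FE; set chi := finfun _; set H := F :\: G.
have : twist G H * cob chi (H :|: G) = twist G H * phi (H :|: G).
  rewrite -cob_twist //; last by move=> K /negPf GK; rewrite ffunE GK.
  have -> : twist G H * phi (H :|: G) = phi' H by rewrite /phi' FG.
  have [szH|szH] := eqVneq #|H| (p - #|G|)%N.
    rewrite -cpsi //; apply: eq_cob => w _; rewrite ffunE subsetUr.
    have -> : (H :\ w :|: G) :\: G = H :\ w.
      rewrite setDUl setDv setU0; apply/setDidPl.
      by apply: disjointWl FG; rewrite subsetDl.
    by rewrite mulrA twist_sqr mul1r.
  have -> : phi' H = 0.
    rewrite /phi' FG; have [->|/sphi[_]] := eqVneq (phi (H :|: G)) 0; first by rewrite mulr0.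
    by rewrite dUG // => e; rewrite -e addnK eqxx in szH.
  rewrite /cob big1 // => w wH; rewrite ffunE subsetUr.
  have -> : (H :\ w :|: G) :\: G = H :\ w.
    rewrite setDUl setDv setU0; apply/setDidPl.
    by apply: disjointWl FG; rewrite subsetDl.
  rewrite [twist _ _ * _]mulrA twist_sqr mul1r; have [->|/spsi[_ e]] := eqVneq (psi (H :\ w)) 0.
    by rewrite mulr0.
  by move: szH; rewrite (cardsD1 w) wH add1n e eqxx.
move/(congr1 ( *%R (twist G H))); rewrite !mulrA twist_sqr !mul1r.
by [].
Qed.

End CechExactness.

(** * Reisner's criterion *)

Section Pairing.
Variables (k : fieldType) (n : nat).
Implicit Types (p q : {mpoly k[n]}) (phi : 'X_{1..n} -> k).

Definition pairing p phi : k := \sum_(m <- msupp p) p@_m * phi m.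

Lemma pairingwE K p phi : (msize p <= K)%N ->
  pairing p phi = \sum_(m : 'X_{1..n < K}) p@_m * phi m.
Proof.
move=> pK; pose I : subFinType _ := 'X_{1..n < K}.
rewrite /pairing (big_mksub I) //=; first last.
- by move=> x /msize_mdeg_lt /leq_trans; apply.
- by rewrite msupp_uniq.
by rewrite big_rmcond //= => i; move/memN_msupp_eq0 ->; rewrite mul0r.
Qed.

Lemma pairingD p q phi : pairing (p + q) phi = pairing p phi + pairing q phi.
Proof.
pose K := maxn (msize p) (maxn (msize q) (msize (p + q))).
rewrite !(@pairingwE K) ?leq_max ?leqnn ?orbT // -big_split; apply: eq_bigr => m _.
by rewrite mcoeffD mulrDl.
Qed.

Lemma pairingZ c p phi : pairing (c *: p) phi = c * pairing p phi.
Proof.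
pose K := maxn (msize p) (msize (c *: p)).
rewrite !(@pairingwE K) ?leq_max ?leqnn ?orbT // mulr_sumr; apply: eq_bigr => m _.
by rewrite mcoeffZ mulrA.
Qed.

Lemma pairing0 phi : pairing 0 phi = 0.
Proof. by rewrite /pairing msupp0 big_nil. Qed.

Lemma pairing_sum I r (P : pred I) (p : I -> {mpoly k[n]}) phi :
  pairing (\sum_(i <- r | P i) p i) phi = \sum_(i <- r | P i) pairing (p i) phi.
Proof.
by elim/big_rec2: _ => [|i x y _ <-]; rewrite ?pairing0 ?pairingD.
Qed.

Lemma pairingX m phi : pairing 'X_[m] phi = phi m.
Proof. by rewrite /pairing msuppX big_seq1 mcoeffX eqxx mul1r. Qed.

Lemma pairing_mulX p e phi :
  pairing ('X_[e] * p) phi = pairing p (fun m => phi (m + e)%MM).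
Proof.
rewrite {1}[p]mpolyE mulr_sumr pairing_sum; apply: eq_bigr => m _.
by rewrite -scalerAr pairingZ -mpolyXD pairingX addmC.
Qed.

Lemma pairing_linform (t : 'I_n -> k) p phi : pairing (linform t * p) phi =
  \sum_w t w * pairing p (fun m => phi (m + U_(w))%MM).
Proof.
rewrite /linform mulr_suml pairing_sum; apply: eq_bigr => w _.
by rewrite -scalerAl pairingZ pairing_mulX.
Qed.

Lemma eq_pairing p phi psi : {in msupp p, phi =1 psi} -> pairing p phi = pairing p psi.
Proof. by move=> e; apply: eq_big_seq => m /e ->. Qed.

Lemma pairing_eq0 p phi : {in msupp p, forall m, phi m = 0} -> pairing p phi = 0.
Proof. by move=> e; apply: big1_seq => m /andP[_ /e ->]; rewrite mulr0. Qed.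

End Pairing.

(** * A contracting homotopy for Koszul complexes *)

Section Homotopy.
Variables (k : fieldType) (n d : nat) (t : 'I_d -> 'I_n -> k).
Variables (q : 'I_d -> {mpoly k[n]}) (s : {ffun 'I_n -> int}).
Implicit Types (phi : {set 'I_d} -> {ffun 'I_n -> int} -> k) (A : {set 'I_d}).

Definition mexp (m : 'X_{1..n}) : {ffun 'I_n -> int} := [ffun u => (m u)%:Z].

Lemma mexpD m w : mexp (m + U_(w))%MM = mexp m + evec w.
Proof. by apply/ffunP => u; rewrite !ffunE mnmDE mnm1E PoszD eq_sym. Qed.

Definition act_lin j (psi : {ffun 'I_n -> int} -> k) a := \sum_w t j w * psi (a - evec w).

Definition act_poly j (psi : {ffun 'I_n -> int} -> k) a :=
  pairing (q j) (fun m => psi (a + s - mexp m)).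

Definition kosz1 phi A a :=
  \sum_(j | j \notin A) sgn k A j * act_lin j (phi (j |: A)) a.

Definition htpy phi A a :=
  \sum_(j in A) sgn k A j * act_poly j (phi (A :\ j)) a.

Lemma act_lin_sum j I (r : seq I) (P : pred I) (c : I -> k) psi a :
  act_lin j (fun b => \sum_(i <- r | P i) c i * psi i b) a =
  \sum_(i <- r | P i) c i * act_lin j (psi i) a.
Proof.
rewrite /act_lin; under eq_bigr do rewrite mulr_sumr.
rewrite exchange_big; apply: eq_bigr => i _; rewrite mulr_sumr.
by apply: eq_bigr => w _; rewrite mulrCA.
Qed.

Lemma act_poly_sum j I (r : seq I) (P : pred I) (c : I -> k) psi a :
  act_poly j (fun b => \sum_(i <- r | P i) c i * psi i b) a =
  \sum_(i <- r | P i) c i * act_poly j (psi i) a.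
Proof.
rewrite /act_poly /pairing; under eq_bigr do rewrite mulr_sumr.
rewrite exchange_big; apply: eq_bigr => i _; rewrite mulr_sumr.
by apply: eq_bigr => w _; rewrite mulrCA.
Qed.

Lemma act_comm i j psi a : act_lin i (act_poly j psi) a = act_poly j (act_lin i psi) a.
Proof.
rewrite /act_lin /act_poly /pairing; under eq_bigr do rewrite mulr_sumr.
rewrite exchange_big; apply: eq_bigr => m _; rewrite mulr_sumr.
by apply: eq_bigr => w _; rewrite mulrCA; rewrite [a - _ + s]addrAC [a + s - evec w - _]addrAC.
Qed.

Lemma sgn_cross A i j : i \in A -> j \notin A ->
  sgn k A j * sgn k (j |: A) i + sgn k A i * sgn k (A :\ i) j = 0.
Proof.
move=> iA jA; have ij : i != j by apply: contraNneq jA => <-.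
have := @sgn_swap k _ (A :\ i) i j ij; rewrite !inE eqxx (negPf jA) andbF setD1K //.
move=> /(_ isT isT); rewrite sgn_selfD.
have -> : j |: (A :\ i) = (j |: A) :\ i.
  by apply/setP => u; rewrite !inE; case: (u =P j) => // ->; rewrite eq_sym ij.
rewrite sgn_selfD; set x := sgn k A i; set y := sgn k A j.
set z := sgn k _ j; set u := sgn k _ i => e.
have xx : x * x = 1 by exact: sgn_sqr.
have uu : u * u = 1 by exact: sgn_sqr.
transitivity (x * x * (y * u) + u * u * (x * z)); first by rewrite xx uu !mul1r.
by transitivity (x * u * (x * y + z * u)); [ring | rewrite e mulr0].
Qed.

(** Exterior multiplication by the vector [q j / x^s] against contraction with [theta]: the cross
    terms cancel by [sgn_cross], leaving multiplication by the sum of the [theta_j q_j / x^s]. *)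
Lemma kosz_htpy phi A a : kosz1 (htpy phi) A a + htpy (kosz1 phi) A a =
  \sum_j act_lin j (act_poly j (phi A)) a.
Proof.
pose cross j i := act_poly i (act_lin j (phi (j |: (A :\ i)))) a.
have DU i j : i \in A -> j \notin A -> (j |: A) :\ i = j |: (A :\ i).
  move=> iA jA; apply/setP => u; rewrite !inE; case: (u =P j) => // ->.
  by case: eqP jA => // ->; rewrite iA.
have -> : kosz1 (htpy phi) A a =
    \sum_(j | j \notin A) act_lin j (act_poly j (phi A)) a +
    \sum_(j | j \notin A) \sum_(i in A) sgn k A j * sgn k (j |: A) i * cross j i.
  rewrite -big_split; apply: eq_bigr => j jA /=; rewrite /htpy act_lin_sum.
  rewrite (bigD1 j) ?setU11 //= setU1K // sgn_self mulrDr mulrA sgn_sqr mul1r.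
  congr (_ + _); rewrite mulr_sumr; apply: eq_big => [i|i].
    by rewrite !inE; case: eqVneq => [->|]; rewrite ?(negPf jA) ?andbT.
  rewrite !inE => /andP[/orP[/eqP->|iA] ij]; first by rewrite eqxx in ij.
  by rewrite mulrA DU // act_comm.
have -> : htpy (kosz1 phi) A a =
    \sum_(j | j \in A) act_lin j (act_poly j (phi A)) a +
    \sum_(j | j \notin A) \sum_(i in A) sgn k A i * sgn k (A :\ i) j * cross j i.
  rewrite [X in _ = _ + X]exchange_big -big_split; apply: eq_bigr => i iA /=.
  rewrite /kosz1 act_poly_sum.
  rewrite (bigD1 i) ?setD11 //= setD1K // sgn_selfD mulrDr mulrA sgn_sqr mul1r.
  rewrite act_comm; congr (_ + _); rewrite mulr_sumr; apply: eq_big => [j|j].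
    by rewrite !inE; case: eqVneq => [->|]; rewrite ?iA ?andbF ?andbT.
  by rewrite mulrA.
rewrite addrACA -big_split /= [X in _ + X]big1 ?addr0 => [|j jA].
  by rewrite addrC [RHS](bigID (mem A)).
by rewrite -big_split big1 //= => i iA; rewrite -mulrDl sgn_cross // mul0r.
Qed.

Lemma act_lin_poly j psi a : act_lin j (act_poly j psi) a =
  pairing (linform (t j) * q j) (fun m => psi (a + s - mexp m)).
Proof.
rewrite pairing_linform; apply: eq_bigr => w _; congr (_ * _).
apply: eq_pairing => m _; rewrite mexpD; congr psi.
by rewrite opprD addrA [a - _ + s]addrAC [LHS]addrAC.
Qed.

End Homotopy.

(** * The double complex and its two filtrations *)

Section Reisner.
Variables (k : fieldType) (n d : nat) (t : 'I_d -> 'I_n -> k).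
Variables (Delta : {set {set 'I_n}}) (J : {set 'I_d}).
Hypothesis complexD : is_complex Delta.

Notation cell := ({set 'I_d} * {set 'I_n} * {ffun 'I_n -> int})%type.
Notation chain := ({set 'I_d} * {set 'I_n} * {ffun 'I_n -> int} -> k).
Notation acyclicD := (acyclic (diff t) (@cdeg n d)).

Definition kc_cell (b : cell) := (b.1.1 \subset J) && allowed Delta b.2 b.1.2.

Lemma arrow_mono x y : arrow t x y -> [/\ y.1.1 \subset x.1.1,
  x.1.2 \subset y.1.2, posx x.2 \subset posx y.2 & negx y.2 \subset negx x.2].
Proof.
case: y => [[A F] a] [[j /= jA [w _ ->]]|[w /= wF ->]]; last by rewrite subsetDl.
split=> //=; first by rewrite subsetUr.
  by apply/subsetP => u; rewrite !inE !ffunE; case: eqP => _ /=; lia.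
by apply/subsetP => u; rewrite !inE !ffunE; case: eqP => _ /=; lia.
Qed.

Lemma kc_convex : convex (arrow t) kc_cell.
Proof.
move=> x y z /arrow_mono[Axy Fxy _ nxy] /arrow_mono[_ Fyz pyz _].
move=> /and3P[AJ nF _] /and3P[_ _ pD]; rewrite /kc_cell /allowed.
rewrite (subset_trans Axy AJ) (subset_trans nxy (subset_trans nF Fxy)).
exact: complexD.2 pD (setUSS pyz Fyz).
Qed.

Section RowLayer.
Hypothesis link_acyclic : forall (G : {set 'I_n}) (s : nat), G \in Delta ->
  (s + #|G| < #|J|)%N -> rbetti k (link Delta G) s = 0%N.

Lemma cardsCU1 (A : {set 'I_d}) j : j \notin A -> #|~: (j |: A)|.+1 = #|~: A|.
Proof.
move=> jA; apply: (@addnI #|A|); rewrite cardsC -(cardsC (j |: A)) cardsU1 jA.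
by rewrite addnS add1n addSn.
Qed.

(** With the size of the exterior part fixed only the Cech differential is left. A cell of degree
    [i] has [#|F| = #|A| + n - i < #|A| <= #|J|], the range of [cech_exact]. *)
Lemma kc_row_acyclic (m i : nat) : (n < i)%N ->
  acyclicD (fun b => kc_cell b && (#|~: b.1.1| == m)) i.
Proof.
move=> ni f sf Df.
have cf (A : {set 'I_d}) (F : {set 'I_n}) a :
    kc_cell (A, F, a) -> #|~: A| = m -> cob (fun H => f (A, H, a)) F = 0.
  move=> X0 Am; have /Df : kc_cell (A, F, a) && (#|~: A| == m) by rewrite X0 Am eqxx.
  rewrite /diff kosz_loc ?add0r => [/eqP|j w jA _].
    by rewrite mulf_eq0 signr_eq0 => /eqP.
  apply: (supported0 sf); apply/negP => /andP[_ /eqP].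
  by rewrite -Am -(cardsCU1 jA) /= => /n_Sn.
(* Primitives are needed for all [A] and [a] at once; [psi] is a finite function and the condition
   boolean so that [sigW] can choose them. *)
have H (A : {set 'I_d}) (a : {ffun 'I_n -> int}) : exists psi : {ffun {set 'I_n} -> k},
    [forall F, (psi F != 0) ==> [&& A \subset J, #|~: A| == m, allowed Delta a F &
                                    cdeg (A, F, a) == i.+1]] &&
    ((A \subset J) && (#|~: A| == m) ==>
       [forall F, allowed Delta a F ==> (cob psi F == (-1) ^+ #|A| * f (A, F, a))]).
  have [AJ|AJ] := boolP ((A \subset J) && (#|~: A| == m)); last first.
    exists [ffun=> 0]; rewrite andbT; apply/forallP => F.
    by rewrite ffunE eqxx.
  case/andP: (AJ) => AJ' Am.
  pose phi (F : {set 'I_n}) := (-1) ^+ #|A| * f (A, F, a).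
  have sphi F : phi F != 0 -> allowed Delta a F /\ (#|A| + (n - #|F|) = i)%N.
    by rewrite mulf_eq0 negb_or => /andP[_ /sf[/andP[/andP[_ ?]]]].
  have Fn (F : {set 'I_n}) : (#|F| <= n)%N by rewrite -[leqRHS]card_ord max_card.
  have cphi F : allowed Delta a F -> cob phi F = 0.
    move=> aF; rewrite -[RHS](mulr0 ((-1) ^+ #|A|)) -(cf A F a); last exact/eqP.
      by rewrite /cob mulr_sumr; apply: eq_bigr => w _; rewrite mulrCA.
    by rewrite /kc_cell AJ'.
  (* With [A] empty no cell has degree [i > n]; as [#|J|] may then be 0, [cech_exact] does not cover
     this case. *)
  have [A0|A0] := posnP #|A|.
    exists [ffun=> 0]; apply/andP; split; apply/forallP => F.
      by rewrite ffunE eqxx.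
    apply/implyP => _; rewrite /cob big1 => [|w _]; last by rewrite ffunE mulr0.
    rewrite eq_sym; apply/idPn => /sphi[_]; rewrite A0; have := Fn F; lia.
  have AleJ := subset_leq_card AJ'.
  have [||//|psi [spsi cpsi]] :=
    @cech_exact k n Delta #|J| complexD link_acyclic a (#|A| + n - i) phi.
  - lia.
  - move=> F /sphi[aF dF]; split=> //; have := Fn F; lia.
  exists psi; apply/andP; split.
    apply/forallP => F; apply/implyP => /spsi[-> e]; rewrite AJ' Am /=.
    by rewrite /cdeg /=; apply/eqP; move: e (Fn F); set x := #|F|; set y := #|A|; lia.
  by apply/forallP => F; apply/implyP => aF; rewrite cpsi.
exists (fun b => sval (sigW (H b.1.1 b.2)) b.1.2) => [[[A F] a]|[[A F] a]] /=.
  case: (sigW _) => psi /= /andP[/forallP/(_ F)/implyP h _] /h.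
  by case/and4P=> AJ Am aF /eqP; rewrite /kc_cell AJ Am aF.
case/andP=> /andP[AJ aF] Am; rewrite /= in AJ Am aF.
rewrite /diff kosz_loc ?add0r => [|j w jA _] /=; last first.
  case: (sigW _) => psi /= /andP[/forallP/(_ F)/implyP h _].
  apply/eqP/idPn => /h/and4P[_ /eqP jAm _ _].
  by move/eqP: Am; rewrite -(cardsCU1 jA) jAm => /esym/n_Sn.
rewrite /cech /=; case: (sigW _) => psi /= /andP[_].
rewrite AJ Am /= => /forallP/(_ F); rewrite aF => /eqP->.
by rewrite mulrA -expr2 sqrr_sign mul1r.
Qed.

End RowLayer.

Section ColumnLayer.
Variables (N : 'I_n -> nat) (q : 'I_n -> 'I_d -> {mpoly k[n]}).
Hypothesis qJ : forall w j, j \notin J -> q w j = 0.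
Hypothesis q_power : forall w m,
  m \in msupp ('X_w ^+ N w - \sum_j linform (t j) * q w j) ->
  [set u | m u != 0%N] \notin Delta.

(** With the size of [F] fixed only the Koszul differential is left, and [x_w] is invertible for [w]
    in [F]: dividing the identity of [q_power] by the power of [x_w] writes 1 as a combination of
    the [theta_j], so [htpy] contracts. *)
Lemma kc_column_acyclic (p i : nat) :
  acyclicD (fun b => kc_cell b && (b.1.2 != set0) && (#|b.1.2| == p)) i.
Proof.
set Y := fun b : cell => _; move=> f sf Df.
pose s w : {ffun 'I_n -> int} := evec w *+ N w.
pose phi (F : {set 'I_n}) (A : {set 'I_d}) (a : {ffun 'I_n -> int}) := f (A, F, a).
(* The choice of [w] depends on [F] alone, which the Koszul differential does not change. *)
pose h (F : {set 'I_n}) A a := if [pick w in F] is Some w then htpy (q w) (s w) (phi F) A a else 0.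
have sphi (F : {set 'I_n}) A a :
    phi F A a != 0 -> [/\ A \subset J, negx a \subset F & posx a :|: F \in Delta].
  by case/sf=> /andP[/andP[/andP[AJ /andP[]]]].
exists (fun b => if Y b then h b.1.2 b.1.1 b.2 else 0).
  move=> [[A F] a]; case: ifP => Yb; last by rewrite eqxx.
  move=> nz; split=> //; move: nz; rewrite /= /h.
  case: pickP => [w wF|]; last by rewrite eqxx.
  apply: contraNeq => degb; rewrite /htpy big1 // => j jA.
  rewrite /act_poly pairing_eq0 ?mulr0 // => m _; apply: (supported_deg sf).
  by move: degb; rewrite /cdeg /= (cardsD1 j A) jA add1n addSn eqSS.
case=> [[A F] a] Yb; rewrite /diff; set g := fun b => _.
case/andP: (Yb) => /andP[/andP[/= AJ /andP[negF posF]] F0] Fp.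
have FDp w : w \in F -> (#|F :\ w| == p) = false.
  by move=> wF; rewrite -(eqP Fp) (cardsD1 w F) wF ltn_eqF.
have -> : cech g (A, F, a) = 0.
  by apply: big1 => w /= wF; rewrite /g ifN ?mulr0 // /Y /= FDp // andbF.
rewrite mulr0 addr0.
have hE B b : h F B b = if [pick w in F] is Some w then htpy (q w) (s w) (phi F) B b else 0.
  by [].
move: hE; case: pickP => [w wF hE|F_0]; last first.
  by case/set0Pn: F0 => w; have := F_0 w; rewrite /= => ->.
have s0 u : u \notin F -> s w u = 0.
  move=> uF; have uw : u != w by apply: contraNneq uF => ->.
  by rewrite /s ffunMnE ffunE (negPf uw) mul0rn.
(* The homotopy divides only by a variable of [F], so a negative exponent elsewhere stays
   negative. *)
have shift0 B b m : ~~ (negx b \subset F) -> phi F B (b + s w - mexp m) = 0.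
  case/subsetPn => u; rewrite inE => bu uF.
  apply/eqP/idPn => /sphi[_ /subsetP/(_ u)]; rewrite inE !ffunE s0 // (negPf uF).
  by move=> nb _; suff: false by []; apply: nb; rewrite addr0 subr_lt0 (lt_le_trans bu).
have -> : kosz t g (A, F, a) = kosz1 t (htpy (q w) (s w) (phi F)) A a.
  apply: eq_bigr => j jA /=; congr (_ * _); apply: eq_bigr => u _ /=; congr (_ * _).
  rewrite /g; case: ifP => [_|Yj]; first exact: hE.
  rewrite /htpy; apply/esym/big1 => l lj; rewrite /act_poly.
  have [nF|nF] := boolP (negx (a - evec u) \subset F); last first.
    by rewrite pairing_eq0 ?mulr0 // => m _; apply: shift0.
  have jJ : j \notin J.
    apply: contraFN Yj => jJ; rewrite /Y /kc_cell /allowed /= F0 Fp nF.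
    rewrite subUset sub1set jJ AJ /= !andbT; apply: complexD.2 posF _.
    by apply/setSU/subsetP => v; rewrite !inE !ffunE; case: eqP => _ /=; lia.
  have [->|ne] := eqVneq l j; first by rewrite qJ // pairing0 mulr0.
  rewrite pairing_eq0 ?mulr0 // => m _; apply/eqP/idPn => /sphi[/subsetP/(_ j)].
  by rewrite !inE eqxx eq_sym ne (negPf jJ) => /(_ isT).
have -> : kosz1 t (htpy (q w) (s w) (phi F)) A a =
    \sum_j act_lin t j (act_poly (q w) (s w) j (phi F A)) a.
  rewrite -kosz_htpy [X in _ = _ + X]big1 ?addr0 // => j jA.
  rewrite /act_poly pairing_eq0 ?mulr0 // => m _.
  set a' := a + _ - _; have [nF|nF] := boolP (negx a' \subset F).
    have := Df (A :\ j, F, a'); rewrite /diff.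
    have -> : cech f (A :\ j, F, a') = 0.
      apply: big1 => u /= uF; rewrite (supported0 sf) ?mulr0 //.
      by rewrite /Y /= FDp // andbF.
    rewrite mulr0 addr0; apply; rewrite /Y /kc_cell /allowed /= F0 Fp nF.
    rewrite (subset_trans (subsetDl _ _) AJ) /= !andbT; apply: complexD.2 posF _.
    apply/subsetP => v; rewrite inE [v \in _ :|: _]inE; case vF: (v \in F); rewrite ?orbT //.
    by rewrite !orbF !inE !ffunE s0 ?vF // addr0 subr_gt0; apply: le_lt_trans.
  rewrite /kosz1 big1 // => l _; rewrite /act_lin big1 ?mulr0 // => u _.
  have [->|/sphi[_ nF']] := eqVneq (phi F (l |: A :\ j) (a' - evec u)) 0; first by rewrite mulr0.
  case/negP: nF; apply: subset_trans nF'; apply/subsetP => v.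
  rewrite !inE [(a' - evec u) v]ffunE [(- evec u) v]ffunE [evec u v]ffunE.
  by move: (a' v) => z; case: eqP => _ /=; lia.
under eq_bigr do rewrite act_lin_poly.
rewrite -pairing_sum; set S := \sum_j _.
have -> : S = 'X_w ^+ N w + (-1) *: ('X_w ^+ N w - S).
  by rewrite scaleN1r opprB addrC subrK.
rewrite pairingD pairingZ [X in _ + _ * X]pairing_eq0 ?mulr0 ?addr0.
  rewrite mpolyXn pairingX; congr (f (_, _, _)).
  apply/ffunP => u; rewrite !ffunE /s ffunMnE ffunE mulmnE mnm1E eq_sym.
  by case: eqP => _; rewrite ?mul1n ?mul0n ?mul0rn ?subr0 ?addr0 // natz addrK.
move=> m /q_power mD; apply/eqP; apply: contraNT mD => /sphi[_ nF _].
apply: complexD.2 posF _; apply/subsetP => u; rewrite inE => mu; rewrite inE.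
case uF: (u \in F); rewrite ?orbT // orbF inE.
rewrite ltNge; apply/negP => au; move/subsetP/(_ u): nF; rewrite inE !ffunE s0 ?uF //.
rewrite addr0 subr_lt0 (le_lt_trans au) ?ltz_nat ?lt0n // => h'.
by have := h' isT.
Qed.

End ColumnLayer.

(** Rows make the whole double complex acyclic in degrees above [n], columns its subcomplex with [F]
    nonempty in all degrees. The quotient is the Koszul complex of [k[Delta]] on the forms in
    [J]. *)
Theorem reisner i :
    (forall (G : {set 'I_n}) (s : nat), G \in Delta -> (s + #|G| < #|J|)%N ->
       rbetti k (link Delta G) s = 0%N) ->
    (forall w, exists N, exists2 q : 'I_d -> {mpoly k[n]},
       forall j, j \notin J -> q j = 0 &
       {in msupp ('X_w ^+ N - \sum_j linform (t j) * q j), forall m : 'X_{1..n},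
          [set u | m u != 0%N] \notin Delta}) ->
  (n < i)%N -> acyclicD (fun b => kc_cell b && (b.1.2 == set0)) i.
Proof.
case: i => // i lk /fin_all_exists[N /fin_all_exists2[q qJ qN]] ni.
have acX : acyclicD kc_cell i.+1.
  apply: (acyclic_layers (@diff_sub _ _ _ t) (@diff_loc _ _ _ t)
    (@diff_diff _ _ _ t) (@arrow_cdeg _ _ _ t)
    (l := fun b : cell => #|~: b.1.1|) (N := d.+1) kc_convex) => [x y|x _|m].
  - by move=> /arrow_mono[yx _ _ _] _ _; rewrite subset_leq_card // setCS.
  - by rewrite ltnS -[leqRHS]card_ord max_card.
  - exact: kc_row_acyclic.
have acX1 : acyclicD (fun b => kc_cell b && (b.1.2 != set0)) i.
  apply: (acyclic_layers (@diff_sub _ _ _ t) (@diff_loc _ _ _ t)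
    (@diff_diff _ _ _ t) (@arrow_cdeg _ _ _ t)
    (l := fun b : cell => #|b.1.2|) (N := n.+1)) => [x y z Rxy Ryz|x y|x _|m].
  - move=> /andP[Xx Fx] /andP[Xz _]; rewrite (kc_convex Rxy Ryz) //=.
    by case/arrow_mono: Rxy => _ Fxy _ _; apply: subset_neq0 Fxy Fx.
  - by move=> /arrow_mono[_ Fxy _ _] _ _; rewrite subset_leq_card.
  - by rewrite ltnS -[leqRHS]card_ord max_card.
  - exact: (kc_column_acyclic qJ qN).
apply: acyclic_ext (acyclic_quotient (@diff_sub _ _ _ t) (@diff_loc _ _ _ t)
    (@diff_diff _ _ _ t) (@arrow_cdeg _ _ _ t)
  kc_convex _ _ acX acX1) => [b /=|b /andP[]//|x y].
  by case: (kc_cell b) => //=; rewrite negbK.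
move=> /arrow_mono[_ Fxy _ _] /andP[_ Fx] ->; exact: subset_neq0 Fxy Fx.
Qed.

End Reisner.

(** * Ideals and linear systems of parameters *)

Section FaceIdeal.
Variables (k : fieldType) (n : nat).
Implicit Types (D : {set {set 'I_n}}) (p : {mpoly k[n]}) (m : 'X_{1..n}).

Definition msup m : {set 'I_n} := [set u | m u != 0%N].

(* A polynomial is [off D] when it vanishes in the face ring of [D]. *)
Definition off D p := {in msupp p, forall m, msup m \notin D}.

Lemma off0 D : off D 0.
Proof. by move=> m; rewrite msupp0. Qed.

Lemma offD D p1 p2 : off D p1 -> off D p2 -> off D (p1 + p2).
Proof.
by move=> o1 o2 m /msuppD_le; rewrite mem_cat => /orP[/o1|/o2].
Qed.

Lemma offZ D c p : off D p -> off D (c *: p).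
Proof. by move=> o m /msuppZ_le/o. Qed.

Lemma off_sum D I r (P : pred I) (F : I -> {mpoly k[n]}) :
  (forall i, P i -> off D (F i)) -> off D (\sum_(i <- r | P i) F i).
Proof. by move=> o; elim/big_rec: _ => [|i x /o oi ox]; [exact: off0 | exact: offD]. Qed.

Lemma mono_monomial (N : {set 'I_n}) :
  exists2 m, mono k N = 'X_[m] & forall u, m u = (u \in N).
Proof.
exists (\sum_(w in N) U_(w))%MM.
  rewrite /mono; elim/big_rec2: _ => [|w m x _ ->]; first by rewrite mpolyX0.
  by rewrite mpolyXD.
move=> u; rewrite mnm_sumE; case uN: (u \in N).
  rewrite (bigD1 u) //= mnm1E eqxx big1 // => w /andP[_ /negPf wu].
  by rewrite mnm1E wu.
by apply: big1 => w wN; rewrite mnm1E; case: eqP => // wu; rewrite wu uN in wN.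
Qed.

Lemma mem_msupp_linformM (t : 'I_n -> k) p m : m \in msupp (linform t * p) ->
  exists2 u, t u != 0 & m u != 0%N.
Proof.
rewrite mcoeff_msupp /linform mulr_suml raddf_sum /= => nz.
have [u] : exists u, (t u *: 'X_u * p)@_m != 0.
  apply/existsP; apply: contra_neqT nz; rewrite negb_exists => /forallP h.
  by apply: big1 => u _; apply/eqP; rewrite -[_ == _]negbK h.
rewrite -scalerAl mcoeffZ mulf_eq0 negb_or => /andP[tu]; rewrite -mcoeff_msupp.
move=> /msuppM_le /allpairsP[[m1 m2] /= [+ _ ->]]; rewrite msuppX inE => /eqP->.
by exists u => //; rewrite mnmDE mnm1E eqxx.
Qed.

Lemma in_ideal_off D d (t : 'I_d -> 'I_n -> k) p : is_complex D ->
    in_ideal (lsop_gens D t) p ->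
  exists q : 'I_d -> {mpoly k[n]}, off D (p - \sum_j linform (t j) * q j).
Proof.
move=> [_ cD] [c ->]; elim/big_rec: _ => [|i x _ [q oq]].
  exists (fun=> 0); rewrite big1 ?subr0; first exact: off0.
  by move=> j _; rewrite mulr0.
have: nth 0 (lsop_gens D t) i \in lsop_gens D t by rewrite mem_nth.
rewrite {2}/lsop_gens mem_cat => /orP[/mapP[N]|/mapP[j _ ->]].
  rewrite mem_enum inE => ND ->; exists q; rewrite -addrA; apply: offD => // m.
  have [mN -> mNE] := mono_monomial N.
  move=> /msuppM_le /allpairsP[[m1 m2] /= [_ + ->]]; rewrite msuppX inE => /eqP->.
  apply: contra ND => /cD; apply; apply/subsetP => u uN.
  by rewrite inE mnmDE mNE uN addn1.
exists (fun l => q l + (l == j)%:R * c i).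
under eq_bigr do rewrite mulrDr.
rewrite big_split /=.
have -> : \sum_l linform (t l) * ((l == j)%:R * c i) = linform (t j) * c i.
  rewrite (bigD1 j) //= eqxx mul1r big1 ?addr0 // => l /negPf->.
  by rewrite mul0r mulr0.
set S := \sum_j _; have -> : c i * linform (t j) + x - (S + linform (t j) * c i) = x - S by ring.
exact: oq.
Qed.

Lemma mcoeff_pihomog e p m : (pihomog mdeg e p)@_m = if mdeg m == e then p@_m else 0.
Proof.
rewrite {1}[p]mpolyE [pihomog _ _ _]linear_sum raddf_sum /=.
transitivity (\sum_(m' <- msupp p) if mdeg m == e then p@_m' * (m' == m)%:R else 0).
  apply: eq_bigr => m' _; rewrite linearZ /= mcoeffZ pihomogX.
  case: (m' =P m) => [->|ne]; first by case: ifP => _; rewrite ?mcoeffX ?mcoeff0 ?eqxx ?mulr0.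
  by case: ifP => _; rewrite ?mcoeffX ?mcoeff0 ?(introF eqP ne) mulr0 if_same.
case: ifP => _; last by rewrite big1.
rewrite [in RHS](mpolyE p) raddf_sum; apply: eq_bigr => m' _ /=.
by rewrite mcoeffZ mcoeffX.
Qed.

Lemma off_pihomog D e p : off D p -> off D (pihomog mdeg e p).
Proof.
move=> o m; rewrite mcoeff_msupp mcoeff_pihomog; case: ifP; rewrite ?eqxx //.
by rewrite -mcoeff_msupp => _ /o.
Qed.

Lemma mcoeff_linformM (t : 'I_n -> k) p m : (linform t * p)@_m =
  \sum_w t w * (if m w == 0%N then 0 else p@_(m - U_(w))%MM).
Proof.
rewrite /linform mulr_suml raddf_sum; apply: eq_bigr => w _ /=.
rewrite -scalerAl mcoeffZ; congr (_ * _); case: eqP => [m0|/eqP m0].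
  apply: memN_msupp_eq0; apply/negP => /msuppM_le /allpairsP[[m1 m2] /= [+ _ mE]].
  by rewrite msuppX inE => /eqP e; move: m0; rewrite mE e mnmDE mnm1E eqxx.
have e : m = (U_(w) + (m - U_(w)))%MM.
  by rewrite addmC submK //; apply/mnm_lepP => u; rewrite mnm1E; case: eqP => // <-; rewrite lt0n.
by rewrite {1}e mulrC mcoeffMX.
Qed.

Lemma pihomog_linformM e (t : 'I_n -> k) p :
  pihomog mdeg e.+1 (linform t * p) = linform t * pihomog mdeg e p.
Proof.
apply/mpolyP => m; rewrite mcoeff_pihomog !mcoeff_linformM.
transitivity (\sum_w t w * (if (m w == 0%N) || (mdeg m != e.+1) then 0 else p@_(m - U_(w))%MM)).
  case: eqP => _; last by rewrite big1 // => w _; rewrite orbT mulr0.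
  by apply: eq_bigr => w _; rewrite orbF.
apply: eq_bigr => w _; congr (_ * _); case: (m w =P 0%N) => //= /eqP m0.
rewrite mcoeff_pihomog.
have {1}-> : m = (m - U_(w) + U_(w))%MM.
  by rewrite submK //; apply/mnm_lepP => u; rewrite mnm1E; case: eqP => // <-; rewrite lt0n.
by rewrite mdegD mdeg1 addn1 eqSS; case: eqP.
Qed.

Lemma pihomog_sum e I r (P : pred I) (F : I -> {mpoly k[n]}) :
  pihomog mdeg e (\sum_(i <- r | P i) F i) = \sum_(i <- r | P i) pihomog mdeg e (F i).
Proof. exact: linear_sum. Qed.

Lemma pihomogZ e c p : pihomog mdeg e (c *: p) = c *: pihomog mdeg e p.
Proof. exact: linearZ. Qed.

(** The quotient is finite-dimensional, so sufficiently many powers of [X_w] are dependent modulo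
    the ideal; the ideal is homogeneous, so one power lies in it. *)
Lemma lsop_power D d (t : 'I_d -> 'I_n -> k) w : is_complex D -> is_lsop D t ->
  exists N, exists q : 'I_d -> {mpoly k[n]},
    off D ('X_w ^+ N - \sum_j linform (t j) * q j).
Proof.
move=> cD [_ [s hs]].
have /fin_all_exists[a ha] : forall i : 'I_(size s).+1, exists a : 'I_(size s) -> k,
    exists q : 'I_d -> {mpoly k[n]},
    off D (('X_w ^+ i.+1 - \sum_l a l *: nth 0 s l) - \sum_j linform (t j) * q j).
  by move=> i; have [a /(in_ideal_off cD)] := hs ('X_w ^+ i.+1); exists a.
have {ha} [q oq] := fin_all_exists ha.
pose M : 'M[k]_((size s).+1, size s) := \matrix_(i, l) a i l.
have : kermx M != 0.
  by rewrite kermx_eq0 /row_free neq_ltn ltnS rank_leq_col.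
case/rowV0Pn => b /sub_kermxP bM /eqP b0.
have [i bi] : exists i, b 0 i != 0.
  apply/existsP; apply: contra_notT b0; rewrite negb_exists => /forallP h.
  by apply/rowP => i; rewrite mxE; apply/eqP; rewrite -[_ == _]negbK h.
pose Q j := \sum_i b 0 i *: q i j.
have oQ : off D (\sum_i b 0 i *: 'X_w ^+ i.+1 - \sum_j linform (t j) * Q j).
  suff -> : \sum_i b 0 i *: 'X_w ^+ i.+1 - \sum_j linform (t j) * Q j =
    \sum_i b 0 i *: (('X_w ^+ i.+1 - \sum_l a i l *: nth 0 s l) - \sum_j linform (t j) * q i j).
    by apply: off_sum => l _; apply: offZ.
  under [RHS]eq_bigr do rewrite !scalerBr.
  rewrite !sumrB; congr (_ - _).
    apply/esym; rewrite -[RHS]subr0; congr (_ - _).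
    under eq_bigr do rewrite scaler_sumr.
    rewrite exchange_big big1 //= => l _.
    under eq_bigr do rewrite scalerA.
    rewrite -scaler_suml; have /matrixP/(_ 0 l) := bM; rewrite !mxE.
    by under eq_bigr do rewrite mxE; move=> ->; rewrite scale0r.
  under [RHS]eq_bigr do rewrite scaler_sumr.
  rewrite exchange_big; apply: eq_bigr => j _ /=; rewrite /Q mulr_sumr.
  by apply: eq_bigr => l _; rewrite scalerAr.
(* Degree [i.+1] retains only the term of index [i]; the cofactors are taken one degree lower, the
   [theta_j] being linear. *)
exists i.+1, (fun j => (b 0 i)^-1 *: pihomog mdeg i (Q j)).
have := @offZ D (b 0 i)^-1 _ (@off_pihomog D i.+1 _ oQ).
have pihX l : pihomog mdeg i.+1 ('X_w ^+ l.+1) = (l == i)%:R *: 'X_w ^+ l.+1 :> {mpoly k[n]}.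
  apply/mpolyP => m; rewrite mcoeff_pihomog mcoeffZ mcoeffXn.
  case: (_ =P m) => [<-|]; last by rewrite mulr0 if_same.
  by rewrite mdegMn mdeg1 mul1n eqSS mulr1; case: eqP.
rewrite pihomogB !pihomog_sum (bigD1 i) //= big1 => [|l li]; last first.
  by rewrite pihomogZ pihX (inj_eq val_inj) (negPf li) scale0r scaler0.
rewrite addr0 pihomogZ pihX eqxx scale1r.
rewrite scalerBr scalerA mulVf // scale1r scaler_sumr.
by congr (off D (_ - _)); apply: eq_bigr => j _; rewrite pihomog_linformM scalerAr.
Qed.

End FaceIdeal.

(** * Local face modules *)

Lemma link_link n (D : {set {set 'I_n}}) (E G : {set 'I_n}) : is_complex D ->
  G \in link D E -> link (link D E) G = link D (G :|: E).
Proof.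
move=> [_ cD]; rewrite inE -setI_eq0 => /and3P[GD GE GED]; apply/setP => H.
rewrite !inE -!setI_eq0 setIUl setIUr !setU_eq0 GE andbT -setUA.
case HD: (H \in D) => //=.
case: (H :&: E == set0); rewrite ?andbF //=.
case: (H :&: G == set0) => //=; case D2: (H :|: (G :|: E) \in D); rewrite ?andbF //=.
by rewrite !(cD _ _ D2) ?setUS ?setSU ?subsetUl ?subsetUr // setUA subsetUl.
Qed.

Lemma link0 n (D : {set {set 'I_n}}) : link D set0 = D.
Proof.
by apply/setP => F; rewrite inE setU0 -setI_eq0 setI0 eqxx /= andbb.
Qed.

(** * Carriers and links in a homology triangulation *)

Section Triangulation.
Variables (k : fieldType) (n : nat) (V : finType).
Variables (Gamma : {set {set 'I_n}}) (sigma : {set 'I_n} -> {set V}).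
Hypothesis Htri : homology_triangulation k Gamma sigma.

Lemma GammaU_complex (U : {set V}) : U != set0 -> is_complex (GammaU Gamma sigma U).
Proof. by case/(Htri.2) => B [[[cU _] _ _ _ _] _]. Qed.

Lemma GammaU_card (U : {set V}) F : U != set0 -> F \in GammaU Gamma sigma U ->
  (#|F| <= #|U|)%N.
Proof. by case/(Htri.2) => B [[[_ [_ h]] _ _ _ _] _] /h. Qed.

(** The link is a sphere at an interior face, a ball at a nonempty boundary face, and the whole ball
    at the empty face; none has homology below the top. *)
Lemma GammaU_link_acyclic (U : {set V}) (H : {set 'I_n}) (s : nat) :
    H \in GammaU Gamma sigma U -> (s + #|H| < #|U|)%N ->
  rbetti k (link (GammaU Gamma sigma U) H) s = 0%N.
Proof.
move=> HU sU; have U0 : U != set0.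
  by apply: contraTneq sU => ->; rewrite cards0.
have [B [[[cU _] acU _ intB bdB] _]] := Htri.2 U U0.
have [HB|HB] := boolP (H \in B); last first.
  have [cL /(_ set0)] := intB _ HU HB; rewrite link0 => -> ; last exact: cL.1.
  by rewrite cards0 addn0; apply/eqP; rewrite eqb0; lia.
have [->|H0] := eqVneq H set0; first by rewrite link0.
by case: (bdB _ HB H0) => B'; case: #|U| => [[]|u [_ h _ _ _]].
Qed.

Lemma rbetti_point (D : {set {set 'I_n}}) : is_complex D ->
  (forall F, F \in D -> F = set0) -> rbetti k D 0 <> 0%N.
Proof.
move=> cD D0 rb.
have [||psi spsi cpsi] := @rbetti_exact k n D 0 (fun F => (F == set0)%:R) cD rb.
- move=> F; case: (F =P set0) => [-> _|_]; last by rewrite eqxx.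
  by rewrite cards0; split=> //; exact: cD.1.
- by move=> F /D0 ->; rewrite cards0.
have := cpsi set0 cD.1 (cards0 _); rewrite eqxx /cob big_set0 => /esym/eqP.
by rewrite oner_eq0.
Qed.

(** If [G] has a nonempty carrier, its [GammaU] is closed under subfaces. The axioms are silent on
    the empty [U]: if [sigma G] is empty and [v] is in [sigma F], then [G] is a vertex in the
    boundary of the ball over [[set v]], but this boundary is a sphere of dimension -1. *)
Lemma carrier_mono (F G : {set 'I_n}) : G \in Gamma -> F \subset G ->
  sigma F \subset sigma G.
Proof.
move=> GG FG; have [sG|sG] := eqVneq (sigma G) set0; last first.
  have [_ /(_ G F)] := GammaU_complex sG.
  by rewrite !inE GG subxx /= => /(_ isT FG)/andP[].
apply/subsetP => v vF; have U0 : [set v] != set0 by apply/set0Pn; exists v; rewrite inE.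
have [G0|[w wG]] := set_0Vmem G.
  by have <- : F = G by apply/eqP; move: FG; rewrite G0 subset0.
have GU : G \in GammaU Gamma sigma [set v] by rewrite inE GG sG sub0set.
have leU := @GammaU_card [set v] _ U0; rewrite cards1 in leU.
have [B [[_ _ [BU [cB sB]] _ _] intB]] := Htri.2 _ U0.
have GB : G \in B.
  apply/negPn/negP => GB; have : G \in [set F in Gamma | sigma F == [set v]].
    by rewrite -intB inE GU.
  by rewrite inE sG GG eq_sym (negPf U0).
have cG : #|G| = 1%N.
  by apply/eqP; rewrite eqn_leq leU //= card_gt0; apply/set0Pn; exists w.
have := sB _ GB 0; rewrite cG cards1 => /rbetti_point[]; first exact: link_complex.
move=> H; rewrite inE => /and3P[_ HG /(subsetP BU)/leU].
rewrite cardsU (_ : _ :&: _ = set0) ?cards0; last by apply/eqP; rewrite setI_eq0.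
by rewrite cG subn0 addn1 ltnS leqn0 cards_eq0 => /eqP.
Qed.

End Triangulation.

(** * Koszul subcomplexes cut out by carriers *)

Section LocalResolution.
Variables (k : fieldType) (n : nat) (V : finType).
Variables (Gamma : {set {set 'I_n}}) (sigma : {set 'I_n} -> {set V}).
Hypothesis Htri : homology_triangulation k Gamma sigma.
Variables (E : {set 'I_n}) (t : 'I_(#|V| - #|E|) -> 'I_n -> k).
Hypothesis HE : E \in Gamma.
Hypothesis Hlsop : is_lsop (link Gamma E) t.
Variable f : V -> 'I_(#|V| - #|E|).
Hypothesis f_inj : {in ~: sigma E &, injective f}.
Hypothesis f_special : forall v, v \notin sigma E -> forall w, t (f v) w != 0 ->
  v \in sigma [set w].

Notation d := (#|V| - #|E|)%N.
Notation cell := ({set 'I_d} * {set 'I_n} * {ffun 'I_n -> int})%type.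
Notation acyclicD := (acyclic (diff t) (@cdeg n d)).
Notation boundaryD := (boundary (diff t) (@cdeg n d)).

Let complexG : is_complex Gamma := Htri.1.
Let Delta := link Gamma E.
Let complexD : is_complex Delta := link_complex complexG HE.

Lemma mem_DeltaU (G : {set 'I_n}) : G \in Delta -> G :|: E \in Gamma.
Proof. by rewrite inE => /and3P[]. Qed.

Lemma Delta_mono (F G : {set 'I_n}) : G \in Delta -> F \subset G ->
  sigma (F :|: E) \subset sigma (G :|: E).
Proof.
by move=> /mem_DeltaU GE FG; apply: (carrier_mono Htri) => //; rewrite setSU.
Qed.

Definition avoiding (S : {set V}) := [set G in Delta | [disjoint sigma (G :|: E) & S]].

Lemma avoiding_complex (S : {set V}) : [disjoint sigma E & S] -> is_complex (avoiding S).
Proof.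
move=> ES; split; first by rewrite inE complexD.1 set0U.
move=> F G; rewrite [F \in _]inE [G \in _]inE => /andP[FD FS] GF.
rewrite (complexD.2 _ _ FD GF) /=.
by apply: disjointWl FS; apply: Delta_mono.
Qed.

Lemma avoiding_link (S : {set V}) : [disjoint sigma E & S] ->
  avoiding S = link (GammaU Gamma sigma (~: S)) E.
Proof.
move=> ES; apply/setP => G; rewrite !inE -!disjoints_subset.
case GE: (G :|: E \in Gamma); rewrite ?andbF //= !andbT.
have [_ cG] := complexG; rewrite (cG _ _ GE) ?subsetUl //=.
case: [disjoint G & E]; rewrite ?andbF //= andb_idl //.
by apply: disjointWl; apply: (carrier_mono Htri) => //; rewrite subsetUl.
Qed.

Definition theta_left (S : {set V}) : {set 'I_d} := ~: (f @: S).

Lemma card_theta_left (S : {set V}) : [disjoint sigma E & S] ->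
  #|theta_left S| = (d - #|S|)%N.
Proof.
move=> ES; have := cardsC (f @: S); rewrite card_ord card_in_imset.
  by rewrite -/(theta_left S); set x := #|theta_left S|; set y := #|S|; lia.
move=> u v uS vS; apply: f_inj; rewrite inE.
  by apply: contraL uS => uE; rewrite (disjointFr ES).
by apply: contraL vS => vE; rewrite (disjointFr ES).
Qed.

(** The link of [G] is that of [G :|: E] in the ball over [~: S], and the ranges agree because
    [#|theta_left S| = #|V| - #|E| - #|S|]. *)
Lemma avoiding_link_acyclic (S : {set V}) (G : {set 'I_n}) (s : nat) :
    [disjoint sigma E & S] -> G \in avoiding S ->
    (s + #|G| < #|theta_left S|)%N ->
  rbetti k (link (avoiding S) G) s = 0%N.
Proof.
move=> ES GS; rewrite card_theta_left // => sG.
have GD : [disjoint G & E] by move: GS; rewrite !inE => /andP[/and3P[]].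
have cGE : #|G :|: E| = (#|G| + #|E|)%N.
  by rewrite cardsU (_ : G :&: E = set0) ?cards0 ?subn0 //; apply/eqP; rewrite setI_eq0.
have cS := cardsC S; rewrite avoiding_link // in GS *.
have U0 : ~: S != set0.
  by rewrite -card_gt0; move: sG cS; set x := #|S|; set y := #|~: S|; lia.
rewrite link_link //; last exact: (GammaU_complex Htri).
apply: (GammaU_link_acyclic Htri); first by move: GS; rewrite inE => /and3P[].
by rewrite cGE; move: sG cS; set x := #|S|; set y := #|~: S|; lia.
Qed.

(** For [v] in [S] every variable of [theta_v] has [v] in its carrier and so vanishes on
    [avoiding S]; these terms drop out of the identity for [Delta]. *)
Lemma avoiding_power (S : {set V}) w : [disjoint sigma E & S] ->
  exists N, exists2 q : 'I_d -> {mpoly k[n]},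
     forall j, j \notin theta_left S -> q j = 0 &
     {in msupp ('X_w ^+ N - \sum_j linform (t j) * q j), forall m : 'X_{1..n},
          [set u | m u != 0%N] \notin avoiding S}.
Proof.
move=> ES; have [N [q oq]] := lsop_power w complexD Hlsop.
exists N, (fun j => if j \in theta_left S then q j else 0) => [j /negPf-> //|].
change (off (avoiding S)
  ('X_w ^+ N - \sum_j linform (t j) * (if j \in theta_left S then q j else 0))).
have -> : 'X_w ^+ N - \sum_j linform (t j) * (if j \in theta_left S then q j else 0) =
    ('X_w ^+ N - \sum_j linform (t j) * q j) +
    \sum_(j | j \notin theta_left S) linform (t j) * q j.
  rewrite [in RHS](bigID (mem (theta_left S))) /= opprD -!addrA; congr (_ + _).
  rewrite [X in _ = _ + X]addrC subrr addr0 [in RHS]big_mkcond /=; congr (- _).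
  by apply: eq_bigr => j _; case: ifP; rewrite ?mulr0.
apply: offD => [m /oq|]; first by rewrite [_ \in avoiding _]inE; apply: contra => /andP[].
apply: off_sum => j; rewrite inE negbK => /imsetP[v vS ->] m.
case/mem_msupp_linformM => u tu mu.
rewrite [_ \in avoiding _]inE; apply/negP => /andP[mD mS].
have vE : v \notin sigma E by apply: contraL vS => vE; rewrite (disjointFr ES).
have := f_special vE tu; apply/negP/(contraL _ vS) => vu; apply: negbT.
apply: (disjointFr mS); apply: subsetP vu.
apply: (carrier_mono Htri); first exact: mem_DeltaU.
by rewrite sub1set !inE mu.
Qed.

(* The subquotient complex attached to [T] and [S]: coefficients in the ideal
   of faces whose carrier contains the [v] in [T] with [theta_v] absent from
   the exterior part, modulo the faces whose carrier meets [S]. *)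
Definition loc_cell (T S : {set V}) (b : cell) :=
  [&& kc_cell (avoiding S) (theta_left S) b, b.1.2 == set0 &
   [forall v in T, (f v \in b.1.1) || (v \in sigma (posx b.2 :|: E))]].

(** An arrow that removes [theta_v] from the exterior part multiplies by a variable with [v] in its
    carrier, so one alternative of the condition at [v] replaces the other. *)
Lemma loc_cell_arrow (T S : {set V}) x y : [disjoint sigma E & T] -> [disjoint sigma E & S] ->
    arrow t x y -> loc_cell T S x -> kc_cell (avoiding S) (theta_left S) y ->
    y.1.2 == set0 ->
  loc_cell T S y.
Proof.
move=> ET ES Rxy /and3P[X0 Fx /forallP Tx] Y0 Fy.
rewrite /loc_cell Y0 Fy /=; apply/forallP => v; apply/implyP => vT.
have yD : posx y.2 \in Delta.
  by move: Y0; rewrite /kc_cell /allowed (eqP Fy) setU0 inE => /and3P[_ _ /andP[]].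
have := Tx v; rewrite vT => /orP[|vx]; last first.
  rewrite (subsetP (Delta_mono yD _) _ vx) ?orbT //.
  by case: (arrow_mono Rxy).
case: Rxy => [[j jA [w tw xE]]|[w]]; last by rewrite (eqP Fy) inE.
rewrite xE /= in_setU1 => /orP[/eqP fj|->] //.
apply/orP; right; rewrite -fj in tw.
have vE : v \notin sigma E by apply: contraL vT => vE; rewrite (disjointFr ET).
apply: subsetP (f_special vE tw); apply: (carrier_mono Htri).
  exact: mem_DeltaU.
rewrite sub1set !inE.
have: w \notin negx x.2.
  by case/and3P: X0 => _ /subsetP nx _; apply/negP => /nx; rewrite (eqP Fx) inE.
by rewrite xE inE /= !ffunE eqxx -leNgt subr_ge0 => /(lt_le_trans ltr01) ->.
Qed.

Lemma loc_convex (T S : {set V}) : [disjoint sigma E & T] -> [disjoint sigma E & S] ->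
  convex (arrow t) (loc_cell T S).
Proof.
move=> ET ES x y z Rxy Ryz Xx /and3P[Xz Fz _].
apply: (loc_cell_arrow ET ES Rxy Xx).
  apply: (kc_convex _ Rxy Ryz) => //; first exact: avoiding_complex.
  by case/and3P: Xx.
by case/arrow_mono: Ryz => _; rewrite (eqP Fz) subset0.
Qed.

(** The condition fails at [v] when [theta_v] is absent and [v] is not in the carrier, which is what
    enlarging [S] by [v] requires. *)
Lemma loc_cell_quotient (T S : {set V}) v b :
    [disjoint sigma E & S] ->
  loc_cell T S b && ~~ loc_cell (v |: T) S b = loc_cell T (v |: S) b.
Proof.
move=> ES; rewrite /loc_cell /kc_cell /allowed.
case: b => [[A F] a] /=; case F0: (F == set0); rewrite ?andbF //= (eqP F0) setU0.
have -> : [forall u in v |: T, (f u \in A) || (u \in sigma (posx a :|: E))] =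
   ((f v \in A) || (v \in sigma (posx a :|: E))) &&
   [forall u in T, (f u \in A) || (u \in sigma (posx a :|: E))].
  apply/forall_inP/andP => [h|[hv /forall_inP hT] u].
    by rewrite h ?setU11 //; split=> //; apply/forall_inP => u uT; rewrite h // setU1r.
  by rewrite in_setU1 => /orP[/eqP->|/hT].
have -> : (A \subset theta_left (v |: S)) = (A \subset theta_left S) && (f v \notin A).
  rewrite /theta_left imsetU1 setCU subsetI andbC; congr (_ && _).
  by rewrite subsetC sub1set inE.
have -> : (posx a \in avoiding (v |: S)) =
    (posx a \in avoiding S) && (v \notin sigma (posx a :|: E)).
  rewrite ![_ \in avoiding _]inE -andbA; congr (_ && _).
  rewrite -!setI_eq0 setIUr setU_eq0 andbC; congr (_ && _).
  by rewrite setI_eq0 disjoint_sym disjoints1.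
set c1 := A \subset _; set c2 := negx a \subset _; set c3 := posx a \in _.
set c4 := FiniteQuant.quant0b _; set c5 := f v \in A; set c6 := v \in _.
by move: c1 c2 c3 c4 c5 c6 => [] [] [] [] [] [].
Qed.

(** Induction on [T]: the complex of [T :\ v] has that of [T] as subcomplex and, as quotient, its
    analogue with [S] enlarged by [v]. For empty [T] this is [reisner]. *)
Lemma loc_acyclic (T S : {set V}) i : [disjoint sigma E & T] -> [disjoint sigma E & S] ->
  (n < i)%N -> acyclicD (loc_cell T S) i.
Proof.
have [m] := ubnP #|T|; elim: m => // m IHm in T S i * => Tm ET ES ni.
have [T0|[v vT]] := set_0Vmem T.
  apply: acyclic_ext (reisner (avoiding_complex ES) _ _ ni) => [b|G s GS|w].
  - rewrite /loc_cell; have -> : [forall v in T, (f v \in b.1.1) || (v \in sigma (posx b.2 :|: E))].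
      by apply/forall_inP => v; rewrite T0 inE.
    by rewrite andbT.
  - exact: avoiding_link_acyclic.
  - exact: avoiding_power.
have vE : v \notin sigma E by apply: contraL vT => vE; rewrite (disjointFr ET).
have T'm : (#|T :\ v| < m)%N by move: Tm; rewrite (cardsD1 v T) vT.
have ET' : [disjoint sigma E & T :\ v] by apply: disjointWr ET; rewrite subsetDl.
have ES' : [disjoint sigma E & v |: S].
  by rewrite -setI_eq0 setIUr setU_eq0 !setI_eq0 ES disjoint_sym disjoints1 vE.
rewrite -(setD1K vT).
apply: (acyclic_sub (@diff_sub _ _ _ t) (@diff_loc _ _ _ t)
    (@diff_diff _ _ _ t) (@arrow_cdeg _ _ _ t)
  (loc_convex ET' ES)); last 2 first.
- exact: IHm.
- apply: acyclic_ext (IHm (T :\ v) (v |: S) i.+1 _ _ _ _) => //; last exact: ltnW.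
  by move=> b; rewrite loc_cell_quotient.
- move=> b /and3P[X0 F0 /forall_inP h]; rewrite /loc_cell X0 F0 /=.
  by apply/forall_inP => u uT; rewrite h // setU1r.
move=> x y Rxy Xx /and3P[Y0 Fy _]; apply: (loc_cell_arrow _ ES Rxy Xx) => //.
by rewrite setD1K.
Qed.

(** Degree [n] is the ring itself, so the cofactors move into the subcomplex as soon as the
    quotients have no homology in degree [n.+1]. *)
Lemma boundary_local (T : {set V}) f0 : [disjoint sigma E & T] ->
    supported (@cdeg n d) (loc_cell T set0) n f0 ->
  boundaryD (loc_cell set0 set0) n f0 -> boundaryD (loc_cell T set0) n f0.
Proof.
have E0 : [disjoint sigma E & set0] by rewrite -setI_eq0 setI0.
have [m] := ubnP #|T|; elim: m => // m IHm in T * => Tm ET sf bf.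
have [-> //|[v vT]] := set_0Vmem T.
have vE : v \notin sigma E by apply: contraL vT => vE; rewrite (disjointFr ET).
have T'm : (#|T :\ v| < m)%N by move: Tm; rewrite (cardsD1 v T) vT.
have ET' : [disjoint sigma E & T :\ v] by apply: disjointWr ET; rewrite subsetDl.
have subT b : loc_cell T set0 b -> loc_cell (T :\ v) set0 b.
  move=> /and3P[X0 F0 /forall_inP h]; rewrite /loc_cell X0 F0 /=.
  by apply/forall_inP => u /setD1P[_ uT]; rewrite h.
apply: (boundary_sub (@diff_sub _ _ _ t) (@diff_loc _ _ _ t)
    (@diff_diff _ _ _ t) (@arrow_cdeg _ _ _ t)
  (loc_convex ET' E0) subT) => //.
- move=> x y Rxy Xx /and3P[Y0 Fy _]; exact: (loc_cell_arrow ET E0 Rxy Xx).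
- have ES' : [disjoint sigma E & v |: set0].
    by rewrite setU0 disjoint_sym disjoints1.
  apply: acyclic_ext (loc_acyclic ET' ES' (ltnSn n)) => b.
  by rewrite -loc_cell_quotient // setD1K.
apply: IHm => // b /sf[/subT].
by [].
Qed.

Hypothesis Hzero : local_module_zero Gamma sigma E t.

Definition charx (T : {set 'I_n}) : {ffun 'I_n -> int} := [ffun u => (u \in T)%:Z].

Lemma posx_charx T : posx (charx T) = T.
Proof. by apply/setP => u; rewrite inE ffunE; case: (u \in T). Qed.

Lemma negx_charx T : negx (charx T) = set0.
Proof. by apply/setP => u; rewrite !inE ffunE; case: (u \in T). Qed.

Let disjEC : [disjoint sigma E & ~: sigma E].
Proof. by rewrite -setI_eq0 setICr. Qed.

Lemma avoiding0 : avoiding set0 = Delta.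
Proof. by apply/setP => G; rewrite inE -setI_eq0 setI0 eqxx andbT. Qed.

Lemma loc_cell0 A a : loc_cell set0 set0 (A, set0, a) = (negx a == set0) && (posx a \in Delta).
Proof.
rewrite /loc_cell /kc_cell /allowed /= eqxx avoiding0 subset0 setU0.
rewrite /theta_left imset0 setC0 subsetT /=.
have -> : [forall v in set0, (f v \in A) || (v \in sigma (posx a :|: E))].
  by apply/forall_inP => v; rewrite inE.
by rewrite andbT.
Qed.

Lemma loc_cell_charx A T : T \in Delta -> interior sigma (T :|: E) ->
  loc_cell (~: sigma E) set0 (A, set0, charx T).
Proof.
move=> TD /eqP intT.
rewrite /loc_cell /kc_cell /allowed /= eqxx avoiding0 negx_charx posx_charx sub0set setU0 TD.
rewrite /theta_left imset0 setC0 subsetT /=.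
by apply/forall_inP => v _; rewrite intT inE orbT.
Qed.

Lemma boundary_mono M : M \in Delta -> interior sigma (M :|: E) ->
  boundaryD (loc_cell set0 set0) n (fun b => (b == (set0, set0, charx M))%:R).
Proof.
move=> MD intM; have [q oq] := in_ideal_off complexD (Hzero MD intM).
(* The cells concerned have nonnegative exponents, so [absz] changes nothing; the degree test leaves
   one-element [b.1.1], so the sum below is a single cofactor coefficient. *)
pose mn (a : {ffun 'I_n -> int}) : 'X_{1..n} := [multinom absz (a u) | u < n]%MM.
exists (fun b => if loc_cell set0 set0 b && (cdeg b == n.+1) then
   \sum_(j in b.1.1) (q j)@_(mn b.2) else 0) => [b|].
  by case: ifP => [/andP[-> /eqP]|]; rewrite ?eqxx.
case=> [[A F] a] Xb; have /eqP F0 : F == set0 by case/and3P: Xb.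
rewrite F0 {F0} in Xb *; rewrite loc_cell0 in Xb; case/andP: Xb => /eqP na pa.
have a_ge0 u : 0 <= a u.
  by rewrite leNgt; apply/negP => au; have := in_set0 u; rewrite -na inE au.
rewrite /diff [cech _ _]big1 ?mulr0 ?addr0 => [|w]; last by rewrite inE.
have cdeg0 (B : {set 'I_d}) b : cdeg (B, set0 : {set 'I_n}, b) = (#|B| + n)%N.
  by rewrite /cdeg /= cards0 subn0.
have [A0|A0] := eqVneq A set0; last first.
  rewrite kosz_loc => [|j w jA tw]; last first.
    rewrite /= cdeg0 ifN // negb_and; apply/orP; right.
    rewrite /= cardsU1 jA -addn1 [(n + 1)%N]addnC eqn_add2r add1n eqSS.
    by rewrite cards_eq0.
  by case: eqP => // -[] /eqP; rewrite (negPf A0).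
rewrite A0 {A A0}.
transitivity ((\sum_j linform (t j) * q j)@_(mn a)).
  rewrite raddf_sum /=; apply: eq_big => [j|j _]; first by rewrite inE.
  rewrite /sgn (_ : [set u in set0 | _] = set0) ?cards0 ?expr0 ?mul1r; last first.
    by apply/setP => u; rewrite !inE.
  rewrite mcoeff_linformM; apply: eq_bigr => w _; congr (_ * _).
  rewrite cdeg0 setU0 cards1 add1n eqxx andbT loc_cell0 big_set1 mnmE.
  have [aw|aw] := eqVneq (a w) 0.
    rewrite aw /= ifN // negb_and; apply/orP; left; apply/set0Pn; exists w.
    by rewrite inE !ffunE eqxx aw.
  have aw1 : 1 <= a w by rewrite -gtz0_ge1 lt_def aw a_ge0.
  rewrite -[(`|a w| == 0)%N]/(_ == 0)%N absz_eq0 (negPf aw) ifT.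
    congr ((q j)@_ _); apply/mnmP => u; rewrite mnmBE !mnmE !ffunE eq_sym.
    case: eqP => [<-|_] /=; last by rewrite subr0 subn0.
    by move: aw1; lia.
  apply/andP; split.
    apply/eqP/setP => u; rewrite !inE !ffunE ltNge; apply/negbTE; rewrite negbK subr_ge0.
    by case: eqP => [->|_] //=; apply: a_ge0.
  apply: complexD.2 pa _; apply/subsetP => u; rewrite !inE !ffunE.
  by case: eqP => _ /=; lia.
set P := \sum_j _ in oq *.
have -> : P = mono k M - (mono k M - P) by rewrite opprB addrC subrK.
rewrite mcoeffB [X in _ - X](_ : _ = 0) ?subr0; last first.
  apply: memN_msupp_eq0; apply/negP => /oq; apply/negP; rewrite negbK.
  rewrite (_ : msup _ = posx a) //; apply/setP => u.
  by rewrite !inE mnmE absz_eq0 lt_def a_ge0 andbT.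
have [m -> mE] := mono_monomial k M; rewrite mcoeffX; congr (_ %:R).
rewrite xpair_eqE eqxx /=; congr nat_of_bool; apply/eqP/eqP => [e|->].
  apply/ffunP => u; have /mnmP/(_ u) := e; rewrite mnmE mE ffunE => ->.
  by rewrite gez0_abs.
by apply/mnmP => u; rewrite mnmE mE ffunE.
Qed.

(* [c j G] is the coefficient at [x^G] of the cofactor [g_j] in [x^M = \sum_j theta_j g_j]. *)
Lemma local_relation M : M \in Delta -> interior sigma (M :|: E) ->
  exists c : 'I_d -> {set 'I_n} -> k,
    (forall j H, c j H != 0 -> forall v, v \notin sigma E -> f v != j ->
       v \in sigma (H :|: E)) /\
    (forall T, T \in Delta -> interior sigma (T :|: E) ->
       \sum_j \sum_(y in T) t j y * c j (T :\ y) = (T == M)%:R).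
Proof.
move=> MD intM.
have [|g sg Dg] := boundary_local disjEC _ (boundary_mono MD intM).
  move=> b; have [-> _|_] := eqVneq b (set0, set0, charx M); last by rewrite eqxx.
  by rewrite loc_cell_charx // /cdeg /= !cards0 subn0.
exists (fun j H => g ([set j], set0, charx H)); split=> [j H|T TD intT].
  case/sg => /and3P[_ _ /forall_inP h] _ v vE vj.
  by have := h v; rewrite inE vE /= inE (negPf vj) posx_charx => /(_ isT).
have := Dg _ (loc_cell_charx set0 TD intT).
rewrite /diff [cech _ _]big1 ?mulr0 ?addr0 => [|w]; last by rewrite inE.
rewrite xpair_eqE eqxx /= => e.
have <- : (charx T == charx M) = (T == M).
  by apply/eqP/eqP => [e'|-> //]; rewrite -(posx_charx T) e' posx_charx.
rewrite -e; apply: eq_big => [j|j _]; first by rewrite inE.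
rewrite /sgn (_ : [set u in set0 | _] = set0) ?cards0 ?expr0 ?mul1r; last first.
  by apply/setP => u; rewrite !inE.
(* For [w] outside [T] the exponent becomes negative at [w], which no cell with [F = set0]
   allows. *)
rewrite setU0 [RHS](bigID (mem T)) /= [X in _ = _ + X]big1 ?addr0 => [|w wT].
  apply: eq_bigr => w wT; congr (_ * g (_, _, _)); apply/ffunP => u.
  by rewrite !ffunE !inE; case: eqP => [->|_]; rewrite ?wT ?subr0.
rewrite (supported0 sg) ?mulr0 //; apply/negP => /and3P[/and3P[_ /= + _] _ _].
move/subsetP/(_ w); rewrite !inE !ffunE eqxx (negPf wT) => /(_ isT).
by [].
Qed.

End LocalResolution.

(** * Monomials and interior partitions *)

Section Coefficients.
Variables (k : fieldType) (I V : finType) (tau : {set I} -> {set V}) (th : V -> I -> k).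
Hypothesis tau_anti : forall G H : {set I}, G \subset H -> tau H \subset tau G.
Hypothesis th_tau : forall v y (G : {set I}), th v y != 0 -> y \in G -> v \notin tau G.

Definition mingen (M : {set I}) := minset (fun G => tau G == set0) M.

(** At most one [v] contributes; the sum is a way to read off [v] from [tau G], with default 0. *)
Definition wt (G : {set I}) (y : I) : k := \sum_(v | tau G == [set v]) th v y.

(** The coefficient of [x^T] in [x^M], written as the sum of the [c G * theta_v * x^G] over [tau G =
    [set v]]. *)
Definition relation (M : {set I}) (c : {set I} -> k) :=
  forall T, mingen T -> \sum_(y in T) wt (T :\ y) y * c (T :\ y) = (T == M)%:R.

Hypothesis relationP : forall M, mingen M -> exists c, relation M c.

Lemma mingen_tau M : mingen M -> tau M = set0.
Proof. by case/minsetP => /eqP. Qed.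

Lemma mingen_eq (M G : {set I}) : mingen M -> tau G = set0 -> G \subset M -> G = M.
Proof. by case/minsetP => _ h /eqP/h. Qed.

Lemma mingen_exists X : tau X = set0 -> exists2 M, mingen M & M \subset X.
Proof. by move=> /eqP/(@minset_exists _ (fun G => tau G == set0)) [M]; exists M. Qed.

Lemma wtE G v y : tau G = [set v] -> wt G y = th v y.
Proof.
move=> Gv; rewrite /wt (big_pred1 v) // => u; rewrite Gv.
by rewrite eqEcard !cards1 sub1set inE leqnn andbT eq_sym.
Qed.

Lemma wt_neq0 G y : wt G y != 0 -> exists2 v, tau G = [set v] & th v y != 0.
Proof.
have [v /eqP Gv|none] := pickP (fun v => tau G == [set v]).
  by rewrite (wtE _ Gv); exists v.
by rewrite /wt big_pred0 ?eqxx.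
Qed.

Lemma wt_sub G v y : tau G \subset [set v] -> wt G y != 0 -> tau G = [set v] /\ th v y != 0.
Proof.
move=> Gv /wt_neq0[u Gu uy]; move: Gv; rewrite Gu sub1set inE => /eqP uv.
by rewrite -uv.
Qed.

Lemma wt_kill (G H : {set I}) y : wt G y != 0 -> G \subset H -> y \in H -> tau H = set0.
Proof.
move=> /wt_neq0[v Gv vy] GH yH; apply/eqP; rewrite -subset0.
apply/subsetP => u uH; have := subsetP (tau_anti GH) u uH; rewrite Gv inE => /eqP uv.
by have := th_tau vy yH; rewrite -uv uH.
Qed.

Lemma tau_two (G H X : {set I}) v u : tau G = [set v] -> tau H = [set u] -> v != u ->
  G \subset X -> H \subset X -> tau X = set0.
Proof.
move=> Gv Hu vu GX HX; apply/eqP; rewrite -subset0; apply/subsetP => x xX.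
have := subsetP (tau_anti GX) x xX; have := subsetP (tau_anti HX) x xX.
by rewrite Gv Hu !inE => /eqP-> /eqP uv; rewrite uv eqxx in vu.
Qed.

Lemma source M : mingen M -> exists2 w, w \in M & wt (M :\ w) w != 0.
Proof.
move=> gM; have [c /(_ M gM)] := relationP gM; rewrite eqxx => c1.
apply/exists_inP; apply: contra_eqT c1; rewrite negb_exists_in => /forall_inP h.
rewrite big1 1?eq_sym ?oner_eq0 // => y yM.
by rewrite (eqP (negbNE (h y yM))) mul0r.
Qed.

(* If the conclusion failed, comparing coefficients at [M] and at [M] with one
   vertex exchanged for [a] would make the relation for [M] inconsistent. *)
Lemma exchange_source (M : {set I}) a v : mingen M -> a \notin M -> tau [set a] = [set v] ->
  exists2 u, u \in M & th v u != 0.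
Proof.
move=> gM aM av; apply/exists_inP; apply: contraT; rewrite negb_exists_in => /forall_inP h.
have {}h u : u \in M -> th v u = 0 by move=> /h/negPn/eqP.
have [c rc] := relationP gM.
have [w wM] : exists2 w, w \in M & wt (M :\ w) w * c (M :\ w) != 0.
  have := rc M gM; rewrite eqxx => c1.
  apply/exists_inP; apply: contra_eqT c1; rewrite negb_exists_in => /forall_inP h'.
  by rewrite big1 1?eq_sym ?oner_eq0 // => y yM; apply/eqP/negPn/h'.
rewrite mulf_eq0 negb_or => /andP[ew cw]; have [v' Gv' v'w] := wt_neq0 ew.
set G := M :\ w in ew cw Gv'.
have vv' : v != v' by apply: contraNneq v'w => <-; rewrite h.
have [N gN NaG] : exists2 N, mingen N & N \subset a |: G.
  by apply/mingen_exists/(tau_two av Gv' vv'); rewrite ?subsetUl ?subsetUr.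
have aN : a \in N.
  apply/negPn/negP => aN; have NG : N \subset G.
    apply/subsetP => x xN; have := subsetP NaG x xN; rewrite in_setU1 => /orP[/eqP xa|//].
    by rewrite -xa xN in aN.
  have := tau_anti NG; rewrite (mingen_tau gN) Gv' subset0 => /eqP/setP/(_ v').
  by rewrite !inE eqxx.
have NvP y : y \in N -> y != a -> wt (N :\ y) y = 0.
  move=> yN ya; apply/eqP/negPn/negP => /wt_sub - /(_ v)[].
    by rewrite -av; apply: tau_anti; rewrite sub1set !inE eq_sym ya.
  move=> _; rewrite h ?eqxx //; have := subsetP NaG y yN.
  by rewrite !inE (negPf ya) => /andP[].
have [y yN ey] := source gN; have ya : y = a.
  by apply/eqP/negPn/negP => ya; rewrite NvP ?eqxx in ey.
rewrite {y yN}ya in ey.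
have HG : N :\ a \subset G.
  apply/subsetP => x; rewrite !inE => /andP[xa xN]; have := subsetP NaG x xN.
  by rewrite !inE (negPf xa).
have [v3 Hv3 v3a] := wt_neq0 ey; have v3E : v3 = v'.
  by apply/eqP; rewrite eq_sym -in_set1 -Hv3 (subsetP (tau_anti HG)) // Gv' inE.
rewrite {v3}v3E in Hv3 v3a.
have HE : w |: (N :\ a) = M.
  apply: mingen_eq => //.
    by apply: (@wt_kill (N :\ a) _ w); rewrite ?(wtE _ Hv3) ?subsetUr ?setU11.
  by rewrite subUset sub1set wM (subset_trans HG) // subsetDl.
have NaE : N :\ a = G.
  rewrite /G -HE setU1K // inE; apply/nandP; right; apply/negP => wN.
  have := subsetP NaG w wN; rewrite !inE eqxx /= orbF => /eqP wa.
  by rewrite -wa wM in aM.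
have := rc N gN; rewrite (bigD1 a) //= NaE big1 ?addr0 => [|y /andP[yN ya]]; last first.
  by rewrite NvP ?mul0r.
have -> : (N == M) = false by apply: contraNF aM => /eqP <-.
by move/eqP; rewrite mulf_eq0 (negPf cw) orbF (wtE _ Gv') (negPf v3a).
Qed.

Lemma mingen_neq0 M : mingen M -> M != set0.
Proof. by move=> /source[w wM _]; apply/set0Pn; exists w. Qed.

(** Here [tau set0] is a single [v], so [M] also is a single vertex; the relation of [[set u]] read
    at [M] kills the coefficient at [set0], which must be nonzero when it is read at [[set u]]. *)
Lemma mingen_not_singleton u (M : {set I}) : mingen [set u] -> mingen M -> u \notin M -> False.
Proof.
move=> gu gM uM; have [c rc] := relationP gu.
have [w wM /wt_neq0[v' Mv' v'w]] := source gM.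
have := rc _ gu; rewrite eqxx big_set1 setDv => /eqP cu.
have : wt set0 u != 0 by apply: contraTneq cu => ->; rewrite mul0r eq_sym oner_eq0.
move=> /wt_neq0[v v0 vu].
have v'E : v' = v.
  by apply/eqP; rewrite -in_set1 -v0 (subsetP (tau_anti (sub0set (M :\ w)))) // Mv' inE.
have wE : [set w] = M.
  apply: mingen_eq => //; last by rewrite sub1set.
  by apply: (@wt_kill set0 _ w); rewrite ?sub0set ?inE // (wtE _ v0) -v'E.
have := rc _ gM; rewrite -wE big_set1 setDv => /eqP.
have -> : ([set w] == [set u]) = false.
  by apply: contraNF uM => /eqP e'; rewrite -wE e' inE.
rewrite (wtE _ v0) -v'E mulf_eq0 (negPf v'w) => /eqP c0.
by rewrite c0 mulr0 eq_sym oner_eq0 in cu.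
Qed.

(** * Relations along pairs of vertices *)

Section NoSingleton.
Hypothesis tau1 : forall y, tau [set y] != set0.

Lemma wt_pair y z : wt [set y] z != 0 -> tau [set y; z] = set0 /\ y != z.
Proof.
move=> eyz; have yz0 : tau [set y; z] = set0.
  by apply: (wt_kill eyz); rewrite ?sub1set !inE eqxx ?orbT.
by split=> //; apply: contraNneq (tau1 y) => yz; rewrite -yz0 -yz setUid.
Qed.

Lemma mingen_pair y z : tau [set y; z] = set0 -> mingen [set y; z].
Proof.
move=> yz0; have [M gM Myz] := mingen_exists yz0.
suff <- : M = [set y; z] by [].
apply/eqP; rewrite eqEsubset Myz subUset !sub1set /=; apply/andP; split.
  apply/negPn/negP => yM; have : M \subset [set z].
    apply/subsetP => x xM; have := subsetP Myz x xM; rewrite !inE => /orP[/eqP xy|//].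
    by rewrite -xy xM in yM.
  rewrite subset1 (negPf (mingen_neq0 gM)) orbF => /eqP Mz.
  by case/eqP: (tau1 z); rewrite -Mz mingen_tau.
apply/negPn/negP => zM; have : M \subset [set y].
  apply/subsetP => x xM; have := subsetP Myz x xM; rewrite !inE => /orP[//|/eqP xy].
  by rewrite -xy xM in zM.
rewrite subset1 (negPf (mingen_neq0 gM)) orbF => /eqP My.
by case/eqP: (tau1 y); rewrite -My mingen_tau.
Qed.

Lemma relation_pair M c y z : relation M c -> y != z -> tau [set y; z] = set0 ->
  wt [set y] z * c [set y] + wt [set z] y * c [set z] = ([set y; z] == M)%:R.
Proof.
move=> rc yz yz0; rewrite -rc; last exact: mingen_pair.
rewrite (bigD1 z) ?inE ?eqxx ?orbT //= (bigD1 y) ?inE ?eqxx //= big1 ?addr0.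
  by rewrite setUC setU1K ?inE 1?eq_sym // setUC setU1K // inE.
by move=> x; rewrite !inE => /andP[/andP[/orP[]->]].
Qed.

Lemma pair_source y z : y != z -> tau [set y; z] = set0 ->
  (wt [set y] z != 0) || (wt [set z] y != 0).
Proof.
move=> yz yz0; have [c rc] := relationP (mingen_pair yz0).
have := relation_pair rc yz yz0; rewrite eqxx; apply: contra_eqT.
rewrite negb_or !negbK => /andP[/eqP-> /eqP->].
by rewrite !mul0r addr0 eq_sym oner_eq0.
Qed.

(** Both coefficient vectors at [y], [z] lie in the kernel of one linear form in two variables,
    nonzero by [pair_source]. *)
Lemma relation_proportional M M' c c' y z : relation M c -> relation M' c' ->
    y != z -> tau [set y; z] = set0 -> [set y; z] != M -> [set y; z] != M' ->
  c' [set y] * c [set z] = c' [set z] * c [set y].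
Proof.
move=> rc rc' yz yz0 /negPf yM /negPf yM'.
have := relation_pair rc yz yz0; have := relation_pair rc' yz yz0.
rewrite yM yM' /=; have := pair_source yz yz0.
set p := wt [set y] z; set q := wt [set z] y.
set a := c [set y]; set b := c [set z]; set a' := c' [set y]; set b' := c' [set z].
move=> pq h' h; apply/eqP; rewrite -subr_eq0.
have pe : p * (a' * b - b' * a) = 0.
  transitivity (b * (p * a' + q * b') - b' * (p * a + q * b)); first by ring.
  by rewrite h h'; ring.
have qe : q * (a' * b - b' * a) = 0.
  transitivity (a' * (p * a + q * b) - a * (p * a' + q * b')); first by ring.
  by rewrite h h'; ring.
case/orP: pq => [/negPf p0|/negPf q0].
  by move/eqP: pe; rewrite mulf_eq0 p0.
by move/eqP: qe; rewrite mulf_eq0 q0.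
Qed.

(* On a triangle, two relations that vanish on two of its sides are proportional. *)
Lemma no_triangle M c x y z : relation M c ->
    [set x; y] != M -> [set x; z] != M -> [set y; z] != M ->
    x != y -> x != z -> y != z ->
    tau [set x; y] = set0 -> tau [set x; z] = set0 -> tau [set y; z] = set0 ->
  c [set z] = 0.
Proof.
move=> rc xyM xzM yzM xy xz yz xy0 xz0 yz0.
have [c' rc'] := relationP (mingen_pair xy0).
have xzN : [set x; z] != [set x; y].
  by apply: contraNneq yz => /setP/(_ z); rewrite !inE eqxx orbT [z == x]eq_sym (negPf xz) eq_sym.
have yzN : [set y; z] != [set x; y].
  apply: contraNneq xz => /setP/(_ z).
  by rewrite !inE eqxx orbT [z == y]eq_sym (negPf yz) orbF eq_sym.
have ex := relation_proportional rc rc' xz xz0 xzM xzN.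
have ey := relation_proportional rc rc' yz yz0 yzM yzN.
have h := relation_pair rc xy xy0; rewrite (negPf xyM) in h.
have h' := relation_pair rc' xy xy0; rewrite eqxx in h'.
transitivity (wt [set x] y * (c' [set x] * c [set z]) + wt [set y] x * (c' [set y] * c [set z])).
  by rewrite -[LHS]mulr1 -[1]/(1%:R) -h'; ring.
rewrite ex ey; transitivity (c' [set z] * (wt [set x] y * c [set x] + wt [set y] x * c [set y])).
  by ring.
by rewrite h mulr0.
Qed.

(** A minimal [N] inside [p |: G] must be [p |: G], with [p] as only source, so the relation of
    [u |: G] read there gives coefficient 0 at [G]. Read at [u |: G] itself it needs a source other
    than [u]; a face retaining [u] can miss only [v'']. *)
Lemma exchange_partner (G : {set I}) u p v v' v'' :
    mingen (u |: G) -> u \notin G -> p \notin u |: G ->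
    tau G = [set v] -> th v u != 0 -> tau (p |: G) = set0 ->
    tau [set p] = [set v'] -> {in G, forall z, th v' z = 0} ->
    tau [set u] = [set v''] ->
  exists2 z, z \in G & th v'' z != 0.
Proof.
move=> gF uG pF Gv vu pG0 pv' v'G uv''; have [N gN NpG] := mingen_exists pG0.
have pG : p \notin G by apply: contra pF; apply: setU1r.
have pN : p \in N.
  apply/negPn/negP => pN; have NG : N \subset G.
    apply/subsetP => x xN; have := subsetP NpG x xN; rewrite in_setU1 => /orP[/eqP xp|//].
    by rewrite -xp xN in pN.
  have := tau_anti NG; rewrite (mingen_tau gN) Gv subset0 => /eqP/setP/(_ v).
  by rewrite !inE eqxx.
have NG z : z \in N -> z != p -> z \in G.
  by move=> zN /negPf zp; have := subsetP NpG z zN; rewrite in_setU1 zp.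
have eN z : z \in N -> z != p -> wt (N :\ z) z = 0.
  move=> zN zp; apply/eqP/negPn/negP => /wt_sub - /(_ v')[].
    by rewrite -pv'; apply: tau_anti; rewrite sub1set !inE eq_sym zp.
  by move=> _; rewrite v'G ?eqxx // NG.
have [z zN ez] := source gN; have zp : z = p.
  by apply/eqP/negPn/negP => zp; rewrite eN ?eqxx in ez.
rewrite {z zN}zp in ez.
have HG : N :\ p \subset G by apply/subsetP => x /setD1P[xp xN]; rewrite NG.
have [v1 Hv1 v1p] := wt_neq0 ez; have v1E : v1 = v.
  by apply/eqP; rewrite eq_sym -in_set1 -Hv1 (subsetP (tau_anti HG)) // Gv inE.
rewrite {v1}v1E in Hv1 v1p.
have HE : N :\ p = G.
  have uH : u |: (N :\ p) = u |: G.
    apply: mingen_eq => //; last exact: setUS.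
    by apply: (@wt_kill (N :\ p) _ u); rewrite ?(wtE _ Hv1) ?subsetUr ?setU11.
  by rewrite -(setU1K uG) -uH setU1K //; apply: contra uG; apply: (subsetP HG).
have [c rc] := relationP gF.
have cG : c G = 0.
  have := rc N gN; rewrite (bigD1 p) //= HE big1 ?addr0 => [|y /andP[yN yp]]; last first.
    by rewrite eN ?mul0r.
  have -> : (N == u |: G) = false by apply: contraNF pF => /eqP <-.
  by move/eqP; rewrite mulf_eq0 (wtE _ Gv) (negPf v1p) => /eqP.
apply/exists_inP; apply: contraT; rewrite negb_exists_in => /forall_inP h.
have := rc _ gF; rewrite eqxx big1 => [/esym/eqP|z]; first by rewrite oner_eq0.
rewrite in_setU1; have [-> _|zu /= zG] := eqVneq z u; first by rewrite setU1K // cG mulr0.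
suff -> : wt ((u |: G) :\ z) z = 0 by rewrite mul0r.
apply/eqP/negPn/negP => /wt_sub - /(_ v'')[].
  by rewrite -uv''; apply: tau_anti; rewrite sub1set !inE eq_sym zu eqxx.
by move=> _; apply/negP/h.
Qed.

(** Nonvanishing spreads from [a] to some [u] in [F2]. The cases compare what [G = F2 :\ u] misses
    with what [a] misses. *)
Lemma no_disjoint_pair a b (F2 : {set I}) c : relation [set a; b] c ->
    mingen F2 -> a \notin F2 -> b \notin F2 ->
    wt [set a] b != 0 -> c [set a] != 0 -> False.
Proof.
move=> rc gF aF bF eab ca.
have notM y z : (y \in F2) || (z \in F2) -> [set y; z] != [set a; b].
  move=> yz; apply/eqP => E; have : (a \notin [set y; z]) || (b \notin [set y; z]) = false.
    by rewrite E !inE !eqxx orbT.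
  case/orP: yz => [yF|zF].
    have : y \in [set a; b] by rewrite -E !inE eqxx.
    by rewrite !inE => /orP[/eqP ya|/eqP yb]; [rewrite -ya yF in aF | rewrite -yb yF in bF].
  have : z \in [set a; b] by rewrite -E !inE eqxx orbT.
  by rewrite !inE => /orP[/eqP ya|/eqP yb]; [rewrite -ya zF in aF | rewrite -yb zF in bF].
(* The right-hand side at this pair is 0, so its two terms cancel and neither vanishes. *)
have spread y z : (y \in F2) || (z \in F2) -> wt [set y] z != 0 -> c [set y] != 0 ->
    wt [set z] y != 0 /\ c [set z] != 0.
  move=> yzF eyz cy; have [yz0 yz] := wt_pair eyz.
  have := relation_pair rc yz yz0; rewrite (negPf (notM y z yzF)) => h.
  have : wt [set z] y * c [set z] != 0.
    apply: contraTneq (mulf_neq0 eyz cy) => h0; rewrite h0 addr0 in h.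
    by rewrite h eqxx.
  by rewrite mulf_eq0 negb_or => /andP[].
have [v av vb] := wt_neq0 eab.
have [u uF vu] := exchange_source gF aF av.
have eau : wt [set a] u != 0 by rewrite (wtE _ av).
have [eua cu] : wt [set u] a != 0 /\ c [set u] != 0 by apply: spread; rewrite ?uF ?orbT.
have [w um wa] := wt_neq0 eua.
set G := F2 :\ u; have F2E : u |: G = F2 by rewrite setD1K.
have uG : u \notin G by rewrite !inE eqxx.
have GF z : z \in G -> z \in F2 by case/setD1P.
have pairF z : z \in G -> wt [set u] z != 0 -> [/\ wt [set z] u != 0, c [set z] != 0 & G = [set z]].
  move=> zG euz; have zF := GF z zG; have [ezu cz] : wt [set z] u != 0 /\ c [set z] != 0.
    by apply: spread => //; rewrite zF orbT.
  split=> //; have E : [set u; z] = F2.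
    apply: mingen_eq => //; last by rewrite subUset !sub1set uF zF.
    by case/wt_pair: euz.
  rewrite /G -E setU1K // inE; case/setD1P: zG; by rewrite eq_sym.
(* If the source of [F2] is some [z] other than [u], then [pairF] reduces [F2] to [[set u; z]],
   where [u] is a source too. *)
have eGu : wt G u != 0.
  have [z zF ez] := source gF; have [zu|zu] := eqVneq z u; first by rewrite /G -zu.
  have zG : z \in G by rewrite !inE zu.
  have [] := @wt_sub (F2 :\ z) w z _ ez.
    by rewrite -um; apply: tau_anti; rewrite sub1set !inE eq_sym zu.
  by move=> _ wz; have [] := pairF z zG; rewrite ?(wtE _ um) // => ? _ ->.
have [v' Gv' v'u] := wt_neq0 eGu.
have [vv'|vv'] := eqVneq v' v; last first.
  have aG0 : tau (a |: G) = set0.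
    by apply: (tau_two Gv' av vv'); rewrite ?subsetUl ?subsetUr.
  (* A second vertex [y] seen by [theta_v] closes a triangle [a], [u], [y]; without one, [u] can be
     exchanged for [a]. *)
  have [/exists_inP[y yG vy]|/exists_inPn h] := boolP [exists y in G, th v y != 0].
    have yF := GF y yG.
    have eay : wt [set a] y != 0 by rewrite (wtE _ av).
    have [eya cy] : wt [set y] a != 0 /\ c [set y] != 0 by apply: spread; rewrite ?yF ?orbT.
    have yv' : tau [set y] = [set v'].
      have [x yx _] := wt_neq0 eya; rewrite yx.
      have := tau_anti (_ : [set y] \subset G); rewrite sub1set yG yx Gv' => /(_ isT).
      by rewrite sub1set inE => /eqP->.
    have eyu : wt [set y] u != 0 by rewrite (wtE _ yv').
    have [yu0 yu] := wt_pair eyu; have [ay0 ay] := wt_pair eay; have [au0 au] := wt_pair eau.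
    have := no_triangle rc (notM a u _) (notM a y _) (notM u y _) au ay.
    rewrite uF yF !orbT eq_sym [[set u; y]]setUC => /(_ isT isT isT yu au0 ay0 yu0).
    by move/eqP: cy.
  have {}h : {in G, forall z, th v z = 0} by move=> z /h/negPn/eqP.
  have [||z zG wz] := exchange_partner _ uG _ Gv' v'u aG0 av h um; rewrite ?F2E //.
  have zF := GF z zG.
  have [] := pairF z zG; rewrite ?(wtE _ um) // => ezu cz GE.
  have az0 : tau [set a; z] = set0 by rewrite -GE.
  have az : a != z by apply: contraNneq aF => ->.
  have := pair_source az az0; rewrite (wtE _ av) h // eqxx /= => eza.
  have [] := spread z a; rewrite ?zF // => h'.
  by rewrite (wtE _ av) h ?eqxx in h'.
rewrite {v'}vv' in Gv' v'u.
(* Now [G] misses the same [v] as [a], and [theta_v] involves [b], so [b] takes over the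
   exchange. *)
have bG0 : tau (b |: G) = set0.
  by apply: (@wt_kill G _ b); rewrite ?(wtE _ Gv') ?subsetUr ?setU11.
have [/exists_inP[y yG wy]|/exists_inPn h] := boolP [exists y in G, th w y != 0].
  have yF := GF y yG; have euy : wt [set u] y != 0 by rewrite (wtE _ um).
  have [eyu cy GE] := pairF y yG euy; rewrite GE in Gv' bG0.
  have eyb : wt [set y] b != 0 by rewrite (wtE _ Gv').
  have [eby cb] : wt [set b] y != 0 /\ c [set b] != 0 by apply: spread; rewrite ?yF.
  have [x bx xy] := wt_neq0 eby.
  have [yb0 yb] := wt_pair eyb; have [uy0 uy] := wt_pair euy; have [au0 au] := wt_pair eau.
  have [ab0 ab] := wt_pair eab.
  have [xw|xw] := eqVneq x w; last first.
    have bu : b != u by apply: contraNneq bF => ->.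
    have bu0 : tau [set b; u] = set0.
      by apply: (tau_two bx um xw); rewrite ?subsetUl ?subsetUr.
    have := no_triangle rc (notM u y _) (notM u b _) (notM y b _) uy.
    rewrite uF yF [[set u; b]]setUC eq_sym => /(_ isT isT isT bu yb uy0 bu0 yb0).
    by move/eqP: cb.
  rewrite {x}xw in bx xy.
  (* Around the 4-cycle [a], [u], [y], [b] the missing elements alternate [v], [w]; the combination
     below eliminates every value of [c]. *)
  have := relation_pair rc ab ab0; rewrite eqxx (wtE _ av) (wtE _ bx) => h1.
  have := relation_pair rc au au0.
  rewrite (negPf (notM a u _)) ?uF ?orbT // (wtE _ av) (wtE _ um) => h2.
  have := relation_pair rc uy uy0; rewrite (negPf (notM u y _)) ?uF // (wtE _ um) (wtE _ Gv') => h3.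
  have := relation_pair rc yb yb0; rewrite (negPf (notM y b _)) ?yF // (wtE _ bx) (wtE _ Gv') => h4.
  have : th v u * th w y = 0.
    transitivity (th v u * th w y * (th v b * c [set a] + th w a * c [set b])
      - th v b * th w y * (th v u * c [set a] + th w a * c [set u])
      + th v b * th w a * (th w y * c [set u] + th v u * c [set y])
      - th v u * th w a * (th v b * c [set y] + th w y * c [set b])); last by ring.
    by rewrite h1 h2 h3 h4 !mulr0 !subr0 addr0 mulr1.
  by move/eqP; rewrite mulf_eq0 (negPf vu) (negPf wy).
have {}h : {in G, forall z, th w z = 0} by move=> z /h/negPn/eqP.
have [N gN NbG] := mingen_exists bG0.
have uN : u \notin N.
  by apply: contraNN bF => /(subsetP NbG); rewrite in_setU1 (negPf uG) orbF => /eqP <-.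
have [y yN wy] := exchange_source gN uN um.
have yb : y = b.
  apply/eqP; have := subsetP NbG y yN; rewrite in_setU1 => /orP[//|/h wy0].
  by rewrite wy0 eqxx in wy.
rewrite {y yN}yb in wy.
have [ebu cb] : wt [set b] u != 0 /\ c [set b] != 0.
  by apply: (spread u b); rewrite ?uF // (wtE _ um).
have [x bx xu] := wt_neq0 ebu.
(* Otherwise nonvanishing spreads from [b] to [z], then to [u], and [theta_w] would involve [z]. *)
have hx : {in G, forall z, th x z = 0}.
  move=> z zG; apply/eqP/negPn/negP => xz; have zF := GF z zG.
  have [|||ezb cz] := spread b z; rewrite ?zF ?orbT ?(wtE _ bx) //.
  have zv : tau [set z] = [set v].
    have [x' zx' _] := wt_neq0 ezb; rewrite zx'.
    have := tau_anti (_ : [set z] \subset G); rewrite sub1set zG zx' Gv' => /(_ isT).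
    by rewrite sub1set inE => /eqP->.
  have [|||euz _] := spread z u; rewrite ?zF ?(wtE _ zv) //.
  by rewrite (wtE _ um) h ?eqxx in euz.
have [||z zG] := exchange_partner _ uG _ Gv' v'u bG0 bx hx um; rewrite ?F2E //.
by rewrite h ?eqxx.
Qed.

End NoSingleton.

(** One-element generators lie in every generator, so [F1] is a pair. Its own relation has a nonzero
    term at [a] or at [b], and the roles are symmetric. *)
Lemma mingen_intersect (F1 F2 : {set I}) : mingen F1 -> mingen F2 -> (#|F1| <= 2)%N ->
  ~~ [disjoint F1 & F2].
Proof.
move=> g1 g2 c1; apply/negP => F12.
have nF w : w \in F1 -> w \notin F2 by move=> wF; rewrite (disjointFr F12).
have tau1 y : tau [set y] != set0.
  apply/eqP => y0; have [M gM My] := mingen_exists y0.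
  have ME : M = [set y].
    by apply/eqP; move: My; rewrite subset1 (negPf (mingen_neq0 gM)) orbF.
  rewrite ME in gM; have [yF|yF] := boolP (y \in F1); last exact: mingen_not_singleton gM g1 yF.
  exact: mingen_not_singleton gM g2 (nF y yF).
have : #|F1| == 2.
  rewrite eqn_leq c1 /= ltnNge; apply/negP; rewrite leq_eqVlt ltnS leqn0 cards_eq0.
  rewrite (negPf (mingen_neq0 g1)) orbF => /cards1P[y F1y].
  by move: (tau1 y); rewrite -F1y mingen_tau ?eqxx.
case/cards2P => a [b [ab F1E]]; rewrite F1E in g1 nF.
have [c rc] := relationP g1; have ab0 := mingen_tau g1.
have aF : a \notin F2 by rewrite nF ?inE ?eqxx.
have bF : b \notin F2 by rewrite nF ?inE ?eqxx ?orbT.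
have h := relation_pair tau1 rc ab ab0; rewrite eqxx in h.
have [h0|] := eqVneq (wt [set a] b * c [set a]) 0; last first.
  by rewrite mulf_eq0 negb_or => /andP[]; apply: (no_disjoint_pair tau1 rc g2).
have : wt [set b] a * c [set b] != 0 by rewrite h0 add0r in h; rewrite h oner_eq0.
rewrite mulf_eq0 negb_or => /andP[]; rewrite setUC in rc.
exact: (no_disjoint_pair tau1 rc g2).
Qed.

End Coefficients.

(** * Application to a face with an interior partition *)

Theorem theorem1p7 (k : fieldType) (k_inf : infinite_type k) (n : nat) (V : finType)
  (Gamma : {set {set 'I_n}}) (sigma : {set 'I_n} -> {set V})
  (Htri : homology_triangulation k Gamma sigma)
  (Hqg : quasi_geometric Gamma sigma)
  (E : {set 'I_n}) (HE : E \in Gamma)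
  (Hell : local_h_zero k Gamma sigma E)
  (F F1 F2 : {set 'I_n}) (HF : F \in link Gamma E)
  (Hpart : interior_partition sigma E F F1 F2)
  (HF1 : (#|F1| <= 2)%N) :
  U_pyramid sigma E F.
Proof.
case: Hell => t [Hlsop [f [f_inj f_special]] Hzero].
set A := apexes sigma E F in Hpart *.
have [/exists_inP[w wA /eqP w1]|/exists_inPn no_pyramid] :=
  boolP [exists w in A, #|Vw sigma E F w| == 1%N]; first by exists w.
case: Hpart => /and3P[F12 F1A F2A] FE int1 int2; exfalso.
pose P := F1 :|: F2.
have PA : [disjoint P & A] by rewrite /P -setI_eq0 setIUl setU_eq0 !setI_eq0 F1A F2A.
have FE' : F = P :|: A by [].
have FEG : F :|: E \in Gamma by move: HF; rewrite inE => /and3P[].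
have dFE : [disjoint F & E] by move: HF; rewrite inE => /and3P[].
have complexD := link_complex Htri.1 HE.
(* Intersecting with [P] makes [tau] total on vertex sets; minimal sets lie in [P] anyway. *)
pose aug (G : {set 'I_n}) := A :|: (G :&: P).
have augF G : aug G \subset F by rewrite FE' /aug subUset subsetUr subIset // subsetUl orbT.
have augD G : aug G \in link Gamma E by apply: complexD.2 HF (augF G).
have augG G : aug G :|: E \in Gamma by have := augD G; rewrite inE => /and3P[].
pose tau (G : {set 'I_n}) := ~: sigma (aug G :|: E).
have tau_anti (G H : {set 'I_n}) : G \subset H -> tau H \subset tau G.
  by move=> GH; rewrite setCS (carrier_mono Htri) // setSU // setUS // setSI.
have tauE G v : v \in tau G -> v \notin sigma E.
  rewrite inE; apply: contra; apply: subsetP.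
  by apply: (carrier_mono Htri) => //; apply: subsetUr.
(* The two cut-offs are those that [th_tau] needs: [aug] sees only vertices of [P], and [f_special]
   covers only [v] off [sigma E]. *)
pose th v y : k := if (y \in P) && (v \notin sigma E) then t (f v) y else 0.
have th_tau v y (G : {set 'I_n}) : th v y != 0 -> y \in G -> v \notin tau G.
  rewrite /th; case: ifP => [/andP[yP vE] tv yG|]; last by rewrite eqxx.
  rewrite inE negbK; apply: subsetP (f_special v vE y tv).
  by apply: (carrier_mono Htri) => //; rewrite sub1set in_setU /aug in_setU in_setI yG yP orbT.
have mingenP M : mingen tau M -> M \subset P.
  move=> gM; suff <- : M :&: P = M by apply: subsetIr.
  apply: (mingen_eq gM); last exact: subsetIl.
  by rewrite -(mingen_tau gM) /tau /aug -setIA setIid.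
(* A face without the apex [y] misses all of [Vw], which has two elements; a nonzero coefficient
   would give both the same linear form, against [f_inj]. *)
have apex_gone j (y : 'I_n) (H : {set 'I_n}) c : y \in A -> H \subset F :\ y ->
    (forall j H, c j H != 0 -> forall v, v \notin sigma E -> f v != j -> v \in sigma (H :|: E)) ->
    c j H = 0 :> k.
  move=> yA HFy hc; apply/eqP/negPn/negP => /hc{}hc.
  have yE : y \notin E.
    by move: yA; rewrite inE => /andP[yF _]; rewrite (disjointFr dFE yF).
  have subV : H :|: E \subset (F :|: E) :\ y.
    rewrite subUset; apply/andP; split.
      by apply: subset_trans HFy _; rewrite setSD // subsetUl.
    by rewrite subsetD1 subsetUr yE.
  have FyG : (F :|: E) :\ y \in Gamma by apply: Htri.1.2 FEG (subsetDl _ _).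
  have /card_gt1P[v1 [v2 [v1V v2V v12]]] : (1 < #|Vw sigma E F y|)%N.
    rewrite ltn_neqAle eq_sym no_pyramid //= card_gt0.
    move: yA; rewrite inE => /andP[_]; apply: contra => /eqP V0.
    by rewrite /interior -[sigma _]setCK -/(Vw _ _ _ _) V0 setC0.
  have VE v : v \in Vw sigma E F y -> v \notin sigma E.
    rewrite inE; apply: contra; apply: subsetP; apply: (carrier_mono Htri) => //.
    exact: subset_trans (subsetUr H E) subV.
  have Vj v : v \in Vw sigma E F y -> f v = j.
    move=> vV; apply/eqP/negPn/negP => vj; have := hc v (VE v vV) vj.
    move=> /(subsetP (carrier_mono Htri FyG subV)).
    by move: vV; rewrite inE => /negPf->.
  have : f v1 = f v2 by rewrite !Vj.
  by move/f_inj; rewrite !inE !VE // => /(_ isT isT) v12'; rewrite v12' eqxx in v12.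
have relationP M : mingen tau M -> exists c : {set 'I_n} -> k, relation tau th M c.
  move=> gM; have intM : interior sigma (aug M :|: E).
    by rewrite /interior -[sigma _]setCK -/(tau M) (mingen_tau gM) setC0.
  have [c [hc sumc]] := local_relation Htri HE Hlsop f_inj f_special Hzero (augD M) intM.
  (* When [tau G] is the single [v], only the cofactor of [theta_v] can be nonzero at [aug G]. *)
  exists (fun G => \sum_(v | tau G == [set v]) c (f v) (aug G)) => T gT.
  have intT : interior sigma (aug T :|: E).
    by rewrite /interior -[sigma _]setCK -/(tau T) (mingen_tau gT) setC0.
  have TP := mingenP T gT; have MP := mingenP M gM.
  have augE (G : {set 'I_n}) : G \subset P -> aug G = A :|: G.
    by move=> GP; rewrite /aug (setIidPl GP).
  have <- : (aug T == aug M) = (T == M).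
    apply/eqP/eqP => [|-> //]; rewrite !augE // => e.
    have AI (G : {set 'I_n}) : G \subset P -> (A :|: G) :\: A = G.
      move=> GP; rewrite setDUl setDv set0U; apply/setDidPl.
      exact: disjointWl GP PA.
    by rewrite -(AI T) // e AI.
  rewrite -(sumc _ (augD T) intT) exchange_big /= augE //.
  rewrite [in RHS](bigID (mem A)) /= [X in _ = X + _]big1 ?add0r; last first.
    move=> y /andP[_ yA]; apply: big1 => j _; rewrite (apex_gone j y _ c) ?mulr0 //.
    by rewrite -augE // setSD.
  apply: eq_big => [y|y yT].
    rewrite in_setU; case yT: (y \in T); rewrite ?orbF ?andbN ?orbT //=.
    by have := subsetP TP y yT => yP; rewrite (disjointFr PA).
  have yP := subsetP TP y yT.
  have yA : y \notin A by rewrite (disjointFr PA).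
  have -> : (A :|: T) :\ y = aug (T :\ y).
    rewrite augE; last exact: subset_trans (subsetDl _ _) TP.
    by apply/setP => x; rewrite in_setU !in_setD1 in_setU; case: eqP => // ->; rewrite (negPf yA).
  have [v /eqP Tv|none] := pickP (fun v => tau (T :\ y) == [set v]).
    have vT : v \in tau (T :\ y) by rewrite Tv inE.
    rewrite (wtE _ _ Tv) (big_pred1 v) => [|u]; last first.
      by rewrite Tv eqEcard !cards1 sub1set inE leqnn andbT eq_sym.
    rewrite /th yP (tauE _ _ vT) /= (bigD1 (f v)) //= big1 ?addr0 // => j jv.
    have [->|/hc/(_ v (tauE _ _ vT))] := eqVneq (c j (aug (T :\ y))) 0; first by rewrite mulr0.
    by rewrite eq_sym jv => /(_ isT); move: vT; rewrite inE => /negPf->.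
  (* An empty [tau (T :\ y)] contradicts minimality, and two elements in it would share a linear
     form. *)
  rewrite /wt [X in X * _]big_pred0 => [|v]; last exact: none.
  rewrite mul0r big1 // => j _.
  have [->|/hc hj] := eqVneq (c j (aug (T :\ y))) 0; first by rewrite mulr0.
  have Tj v : v \in tau (T :\ y) -> f v = j.
    move=> vT; apply/eqP/negPn/negP => vj; have := hj v (tauE _ _ vT) vj.
    by move: vT; rewrite inE => /negPf->.
  have [T0|[v vT]] := set_0Vmem (tau (T :\ y)).
    have := mingen_eq gT T0 (subsetDl _ _) => /setP/(_ y).
    by rewrite !inE eqxx yT.
  have := none v; rewrite eqEsubset sub1set vT andbT => /negP[]; apply/subsetP => u uT.
  rewrite inE; apply/eqP/f_inj; rewrite ?inE ?(tauE _ _ vT) ?(tauE _ _ uT) //.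
  by rewrite !Tj.
have tau0 (G : {set 'I_n}) : G \subset P -> interior sigma (G :|: A :|: E) -> tau G = set0.
  by move=> GP /eqP; rewrite /tau /aug (setIidPl GP) [A :|: G]setUC => ->; rewrite setCT.
have [M1 g1 M1F] := mingen_exists (tau0 F1 (subsetUl _ _) int1).
have [M2 g2 M2F] := mingen_exists (tau0 F2 (subsetUr _ _) int2).
have c1 : (#|M1| <= 2)%N by apply: leq_trans HF1; apply: subset_leq_card.
have := mingen_intersect tau_anti th_tau relationP g1 g2 c1.
by rewrite (disjointWl M1F) // (disjointWr M2F).
Qed.
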